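(* A ring is finite and minimal noncommutative if and only if it belongs (up to isomorphism) to one of the following three classes, and these three classes are pairwise disjoint (no ring of one class is isomorphic to a ring of another class). (1) For a prime $p$, the ring $U_p=\left\{\begin{pmatrix}a&b\\0&c\end{pmatrix}: a,b,c\in F_p\right\}$ of upper triangular $2\times 2$ matrices over $F_p$. (2) For primes $p$ and $q$, and integers $m\geq 1$ and $1\leq j\leq q-1$, the ring \[B_{p,q^m,jq^{m-1}}=\left\{\begin{pmatrix}x^{p^{jq^{m-1}}}&y\\0&x\end{pmatrix}: x,y\in F_{p^{q^m}}\right\}.\] (3) For a prime $p$ and an integer $n\geq 3$, the minimal noncommutative homomorphic images of \[A=\mathbb{Z}\langle x,y\rangle/\left(I+(p,x,y)^n\right),\] where $I=(p,x,y)[x,y]\,\mathbb{Z}\langle x,y\rangle+\mathbb{Z}\langle x,y\rangle\,[x,y](p,x,y)$.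
   Context: All rings are associative with $1$, and subrings of a ring contain its identity element. $F_q$ denotes the finite field of order $q$. A ring $R$ is called minimal noncommutative if $R$ is not commutative, every proper subring of $R$ is commutative, and every proper homomorphic image of $R$ (quotient by a nonzero two-sided ideal) is commutative. $\mathbb{Z}\langle x,y\rangle$ is the free associative ring on $x,y$; $[x,y]=xy-yx$; $(p,x,y)$ is the two-sided ideal of $\mathbb{Z}\langle x,y\rangle$ generated by $p,x,y$. *)

(* Defs.v *)
From HB Require Import structures.
From mathcomp Require Import all_boot all_order all_algebra all_field.
From mathcomp Require Import ring_quotient generic_quotient.
From mathcomp Require Import boolp classical_sets cardinality.
From mathcomp Require Import monalg.

Set Implicit Arguments.
Unset Strict Implicit.
Unset Printing Implicit Defensive.

Import GRing.Theory.
Local Open Scope classical_set_scope.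
Local Open Scope ring_scope.
Local Open Scope quotient_scope.

Section IdealOps.
Variable R : pzRingType.
Implicit Types A B : set R.

Definition is_subgroup A : Prop :=
  A 0 /\ (forall x y, A x -> A y -> A (x - y)).

Definition is_ideal A : Prop :=
  is_subgroup A /\ (forall a x, A x -> A (a * x) /\ A (x * a)).

Definition gen_ideal A : set R := smallest is_ideal A.

(* The usual convention for products of ideals: AB is the additive subgroup
   generated by the products ab. *)
Definition set_prod A B : set R :=
  smallest is_subgroup [set a * b | a in A & b in B].

Definition set_sum A B : set R := [set a + b | a in A & b in B].

Definition ideal_pow A (n : nat) : set R := iter n (set_prod A) setT.

Lemma gen_ideal_ideal A : is_ideal (gen_ideal A).
Proof.
split; first split.
- by move=> B [[[]]].
- by move=> x y Ax Ay B BA; have [[[_ +] _] _] := BA; apply; [apply: Ax|apply: Ay].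
- move=> a x Ax; split=> B BA; have [[_ h] _] := BA.
  + by case: (h a x (Ax _ BA)).
  + by case: (h a x (Ax _ BA)).
Qed.

Lemma set_prod_subgroup A B : is_subgroup (set_prod A B).
Proof.
split; first by move=> C [[]].
by move=> x y Ax Ay C CA; have [[_ +] _] := CA; apply; [apply: Ax|apply: Ay].
Qed.

Lemma set_prodP A B (C : set R) : is_subgroup C ->
  (forall a b, A a -> B b -> C (a * b)) -> set_prod A B `<=` C.
Proof.
move=> sC h x; apply; split=> // _ [a Aa [b Bb <-]]; exact: h.
Qed.

Lemma set_prod_mem A B a b : A a -> B b -> set_prod A B (a * b).
Proof. by move=> Aa Bb C [_]; apply; exists a => //; exists b. Qed.

Lemma set_prod_closedl A B :
  (forall a x, A x -> A (a * x)) ->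
  forall a x, set_prod A B x -> set_prod A B (a * x).
Proof.
move=> hA a x; apply: (@set_prodP A B (fun x => set_prod A B (a * x))).
  have [h0 hB] := set_prod_subgroup A B.
  by split=> [|u v]; rewrite ?mulr0 // mulrBr; apply: hB.
by move=> u v Au Bv; rewrite mulrA; apply: set_prod_mem => //; apply: hA.
Qed.

Lemma set_prod_closedr A B :
  (forall a x, B x -> B (x * a)) ->
  forall a x, set_prod A B x -> set_prod A B (x * a).
Proof.
move=> hB a x; apply: (@set_prodP A B (fun x => set_prod A B (x * a))).
  have [h0 hS] := set_prod_subgroup A B.
  by split=> [|u v]; rewrite ?mul0r // mulrBl; apply: hS.
by move=> u v Au Bv; rewrite -mulrA; apply: set_prod_mem => //; apply: hB.
Qed.

Lemma set_prod_ideal A B :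
  (forall a x, A x -> A (a * x)) -> (forall a x, B x -> B (x * a)) ->
  is_ideal (set_prod A B).
Proof.
move=> hA hB; split; first exact: set_prod_subgroup.
by move=> a x ABx; split; [apply: set_prod_closedl|apply: set_prod_closedr].
Qed.

Lemma set_sum_ideal A B : is_ideal A -> is_ideal B -> is_ideal (set_sum A B).
Proof.
move=> [[A0 AB] AM] [[B0 BB] BM]; split; first split.
- by exists 0 => //; exists 0 => //; rewrite addr0.
- move=> _ _ [a Aa [b Bb <-]] [c Ac [d Bd <-]].
  exists (a - c); first exact: AB.
  by exists (b - d); [apply: BB|rewrite opprD addrACA].
- move=> r _ [a Aa [b Bb <-]]; have [? ?] := AM r _ Aa; have [? ?] := BM r _ Bb.
  split.
  + by exists (r * a) => //; exists (r * b) => //; rewrite mulrDr.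
  + by exists (a * r) => //; exists (b * r) => //; rewrite mulrDl.
Qed.

Lemma ideal_pow_ideal A n : is_ideal A -> is_ideal (ideal_pow A n).
Proof.
move=> [_ hA]; elim: n => [|n [_ IH]]; first by do 2!split.
by apply: set_prod_ideal => a x h; [case: (hA a x h)|case: (IH a x h)].
Qed.

End IdealOps.

(* MathComp only provides quotient rings of commutative rings; this is the
   quotient by an arbitrary two-sided ideal, built on its quotient groups. *)
Record ideal (R : pzRingType) := Ideal {
  ideal_set : set R;
  ideal_setP : is_ideal ideal_set
}.

Definition ideal_pred (R : pzRingType) (I : ideal R) : {pred R} :=
  fun x => `[< ideal_set I x >].

Lemma ideal_pred_zmod_closed (R : pzRingType) (I : ideal R) :
  zmod_closed (ideal_pred I).
Proof.
have [[I0 IB] _] := ideal_setP I.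
by split=> [|x y /asboolP Ix /asboolP Iy]; apply/asboolP => //; apply: IB.
Qed.

HB.instance Definition _ (R : pzRingType) (I : ideal R) :=
  GRing.isZmodClosed.Build R (ideal_pred I) (ideal_pred_zmod_closed I).

Definition quot_ring (R : pzRingType) (I : ideal R) : Type :=
  Quotient.quot (ideal_pred I).

HB.instance Definition _ (R : pzRingType) (I : ideal R) :=
  GRing.Zmodule.on (quot_ring I).
HB.instance Definition _ (R : pzRingType) (I : ideal R) :=
  EqQuotient.on (quot_ring I).

Section QuotRing.
Variables (R : pzRingType) (I : ideal R).
Local Notation Q := (quot_ring I).

Definition quot_one : Q := \pi_Q 1.
Definition quot_mul (u v : Q) : Q := \pi_Q (repr u * repr v).

Lemma quot_eqP (x y : R) : \pi_Q x = \pi_Q y <-> ideal_set I (x - y).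
Proof.
have E := Quotient.idealrBE (ideal_pred I) x y.
split=> [/eqP|Ixy]; first by rewrite -E => /asboolP.
by apply/eqP; rewrite -E; apply/asboolP.
Qed.

Lemma quot_piM (x y : R) : quot_mul (\pi_Q x) (\pi_Q y) = \pi_Q (x * y).
Proof.
apply/quot_eqP; set x' := repr _; set y' := repr _.
have Ix : ideal_set I (x' - x) by apply/quot_eqP; rewrite reprK.
have Iy : ideal_set I (y - y') by apply/quot_eqP; rewrite reprK.
have [[I0 IB] IM] := ideal_setP I.
have -> : x' * y' - x * y = (x' - x) * y' - x * (y - y').
  by rewrite mulrBl mulrBr opprB addrA subrK.
by apply: IB; [case: (IM y' _ Ix)|case: (IM x _ Iy)].
Qed.

Lemma quot_piD (x y : R) : (\pi_Q x : Q) + \pi_Q y = \pi_Q (x + y).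
Proof. exact: esym (Quotient.pi_add (ideal_pred I) x y). Qed.

Lemma quot_mulA : associative quot_mul.
Proof.
move=> x y z; rewrite -[x]reprK -[y]reprK -[z]reprK.
rewrite (quot_piM (repr y)) (quot_piM (repr x) (repr y)).
by rewrite (quot_piM _ (repr y * _)) (quot_piM (_ * repr y)) mulrA.
Qed.

Lemma quot_mul1q : left_id quot_one quot_mul.
Proof. by move=> x; rewrite -[x]reprK quot_piM mul1r. Qed.

Lemma quot_mulq1 : right_id quot_one quot_mul.
Proof. by move=> x; rewrite -[x]reprK quot_piM mulr1. Qed.

Lemma quot_mulDl : left_distributive quot_mul +%R.
Proof.
move=> x y z; rewrite -[x]reprK -[y]reprK -[z]reprK.
rewrite quot_piD (quot_piM (_ + _)) (quot_piM _ (repr z)) (quot_piM (repr y)).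
by rewrite quot_piD mulrDl.
Qed.

Lemma quot_mulDr : right_distributive quot_mul +%R.
Proof.
move=> x y z; rewrite -[x]reprK -[y]reprK -[z]reprK.
rewrite quot_piD (quot_piM _ (_ + _)) (quot_piM _ (repr y)) (quot_piM _ (repr z)).
by rewrite quot_piD mulrDr.
Qed.

HB.instance Definition _ := GRing.Zmodule_isPzRing.Build Q
  quot_mulA quot_mul1q quot_mulq1 quot_mulDl quot_mulDr.

End QuotRing.

Definition ring_commutative (R : pzRingType) : Prop :=
  commutative (@GRing.mul R).

Definition ring_iso (R S : pzRingType) : Prop :=
  exists f : {rmorphism R -> S}, bijective f.

Definition homomorphic_image (A R : pzRingType) : Prop :=
  exists f : {rmorphism A -> R}, forall r, exists a, f a = r.

Definition minimal_noncommutative (R : pzRingType) : Prop :=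
  [/\ ~ ring_commutative R,
      forall S : {pred R}, subring_closed S -> (exists x, x \notin S) ->
        {in S &, commutative (@GRing.mul R)}
    & forall I : ideal R, (exists2 x, ideal_set I x & x <> 0) ->
        ring_commutative (quot_ring I)].

Definition U_pred (p : nat) : {pred 'M['F_p]_2} := fun M => M 1 0 == 0.

Lemma U_pred_closed p : subring_closed (@U_pred p).
Proof.
split=> [|M N|M N]; rewrite !unfold_in.
- by rewrite !mxE.
- by move=> /eqP M0 /eqP N0; rewrite !mxE M0 N0 subrr.
- move=> /eqP M0 /eqP N0; rewrite mxE big_ord_recl big_ord1 /=.
  rewrite M0 mul0r add0r (_ : lift _ _ = 1) ?N0 ?mulr0 //.
  exact: val_inj.
Qed.

HB.instance Definition _ p :=
  GRing.isSubringClosed.Build _ (@U_pred p) (@U_pred_closed p).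

Record U_ring (p : nat) := URing {
  U_val :> 'M['F_p]_2;
  U_valP : U_val \in @U_pred p
}.

HB.instance Definition _ p := [isSub for @U_val p].
HB.instance Definition _ p := [Choice of U_ring p by <:].
HB.instance Definition _ p := [SubChoice_isSubNzRing of U_ring p by <:].

Definition GF (p k : nat) (pr_p : prime p) (k_gt0 : (0 < k)%N) : finFieldType :=
  s2val (pPrimePowerField pr_p k_gt0).

Lemma pchar_GF p k (pr_p : prime p) (k_gt0 : (0 < k)%N) :
  p \in [pchar GF pr_p k_gt0].
Proof. exact: s2valP (pPrimePowerField pr_p k_gt0). Qed.

Lemma card_GF p k (pr_p : prime p) (k_gt0 : (0 < k)%N) :
  #|GF pr_p k_gt0| = (p ^ k)%N.
Proof. exact: s2valP' (pPrimePowerField pr_p k_gt0). Qed.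

Section BRing.
(* B_{p,k,e}: the matrices (x^(p^e), y; 0, x) with x, y in F_(p^k). *)
Variables (p k : nat) (pr_p : prime p) (k_gt0 : (0 < k)%N) (e : nat).
Local Notation F := (GF pr_p k_gt0).

Definition B_pred : {pred 'M[F]_2} :=
  fun M => (M 1 0 == 0) && (M 0 0 == M 1 1 ^+ (p ^ e)).

Lemma frobB (x y : F) : (x - y) ^+ (p ^ e) = x ^+ (p ^ e) - y ^+ (p ^ e).
Proof.
have pF := pchar_GF pr_p k_gt0.
elim: e => [|n IH]; first by rewrite expn0 !expr1.
by rewrite expnSr !exprM IH -!(pFrobenius_autE pF) rmorphB.
Qed.

Lemma B_pred_closed : subring_closed B_pred.
Proof.
have l1 : lift ord0 ord0 = 1 :> 'I_2 by exact: val_inj.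
split=> [|M N|M N]; rewrite !unfold_in.
- by rewrite !mxE /= expr1n !eqxx.
- move=> /andP[/eqP M0 /eqP M1] /andP[/eqP N0 /eqP N1].
  by rewrite !mxE M0 N0 M1 N1 subrr frobB !eqxx.
- move=> /andP[/eqP M0 /eqP M1] /andP[/eqP N0 /eqP N1].
  rewrite !mxE !big_ord_recl !big_ord0 /= !l1 M0 N0 M1 N1.
  by rewrite !mul0r !mulr0 !addr0 !add0r exprMn !eqxx.
Qed.

HB.instance Definition _ := GRing.isSubringClosed.Build _ B_pred B_pred_closed.

Record B_ring := BRing {
  B_val :> 'M[F]_2;
  B_valP : B_val \in B_pred
}.

HB.instance Definition _ := [isSub for B_val].
HB.instance Definition _ := [Choice of B_ring by <:].
HB.instance Definition _ := [SubChoice_isSubNzRing of B_ring by <:].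

End BRing.

Lemma prime_pow_gt0 (q m : nat) : prime q -> (0 < q ^ m)%N.
Proof. by move=> /prime_gt0 q_gt0; rewrite expn_gt0 q_gt0. Qed.

(* The monoid ring over int of the free monoid on two letters. *)
Definition freeZ2 : pzRingType := {malg int[{fmonom bool}]}.
Definition fx : freeZ2 := << fmu true >>.
Definition fy : freeZ2 := << fmu false >>.

Section AQuotient.
Variables (p n : nat).

Definition pxy : set freeZ2 := gen_ideal [set p%:R; fx; fy].

Definition comm_xy : set freeZ2 := [set fx * fy - fy * fx].

Definition I_rel : set freeZ2 :=
  set_sum (set_prod (set_prod pxy comm_xy) setT)
          (set_prod (set_prod setT comm_xy) pxy).

Definition A_rel : set freeZ2 := set_sum I_rel (ideal_pow pxy n).

Lemma A_rel_ideal : is_ideal A_rel.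
Proof.
have [_ hJ] := gen_ideal_ideal [set p%:R; fx; fy].
apply: set_sum_ideal; last exact/ideal_pow_ideal/gen_ideal_ideal.
apply: set_sum_ideal; apply: set_prod_ideal => a x.
- by apply: set_prod_closedl => b z h; case: (hJ b z h).
- by [].
- by apply: set_prod_closedl.
- by move=> h; case: (hJ a x h).
Qed.

Definition A_ring : pzRingType := quot_ring (Ideal A_rel_ideal).

End AQuotient.

Definition class_U (R : pzRingType) : Prop :=
  exists2 p : nat, prime p & ring_iso R (U_ring p).

Definition class_B (R : pzRingType) : Prop :=
  exists (p q m j : nat) (pr_p : prime p) (pr_q : prime q),
    [/\ (1 <= m)%N, (1 <= j <= q - 1)%N
      & ring_iso R (B_ring pr_p (prime_pow_gt0 m pr_q) (j * q ^ (m - 1))%N)].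

Definition class_A (R : pzRingType) : Prop :=
  exists p n : nat, [/\ prime p, (3 <= n)%N, minimal_noncommutative R
    & homomorphic_image (A_ring p n) R].

(* Main.v *)
Require Import Defs.
From HB Require Import structures.
From mathcomp Require Import all_boot all_algebra all_field.
From mathcomp Require Import cyclic.
From mathcomp Require Import generic_quotient boolp classical_sets cardinality.
From mathcomp Require Import monalg.

(** Let R be a finite minimal noncommutative ring.  Any two noncommuting
    elements generate R, and the commutators lie in every nonzero ideal.

    If some idempotent is nontrivial, then some idempotent e is not central
    (otherwise R would be a product of two commutative rings), so, up to
    replacing e by 1 - e, there is a <> 0 with e a = a and a e = 0; we may take a
    of prime additive order p, and then R is spanned by e, a and 1 - e over F_p.

    Otherwise every element is nilpotent or invertible, the nilpotent elements
    form a nilpotent ideal N, and R/N is a field by Wedderburn's theorem.  If two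
    elements x, y of N do not commute, they generate R, and
    N [x,y] = [x,y] N = 0 because [x,y] generates the minimal ideal: R is an image
    of A.  If N is commutative, lift a generator of the group of units of R/N to
    w of the same order; w is not central, and decomposing R under conjugation
    by w gives a in N with w a = a w^c <> a w.  Minimality forces a^2 = 0 and
    p = 0, so that R = F + a F with F = Z[w] a finite field and x a = a s(x) for
    an automorphism s of F.  Every proper subfield of F is fixed by s, which forces
    |F| = p^(q^m) and s(x) = x^(p^(j q^(m-1))). *)

Set Implicit Arguments.
Unset Strict Implicit.
Unset Printing Implicit Defensive.

Import GRing.Theory.
Local Open Scope classical_set_scope.
Local Open Scope ring_scope.
Local Open Scope quotient_scope.

(** * Minimal noncommutative rings and their isomorphisms *)

Definition is_subring (R : pzRingType) (S : set R) : Prop :=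
  [/\ S 1, forall x y, S x -> S y -> S (x - y)
    & forall x y, S x -> S y -> S (x * y)].

Lemma is_subringD (R : pzRingType) (S : set R) : is_subring S ->
  forall x y, S x -> S y -> S (x + y).
Proof.
case=> S1 SB _ x y Sx Sy; rewrite -[y]opprK -[- y]sub0r.
by apply: (SB) => //; apply: (SB) => //; rewrite -(subrr 1); apply: SB.
Qed.

Lemma is_subring0 (R : pzRingType) (S : set R) : is_subring S -> S 0.
Proof. by case=> S1 SB _; rewrite -(subrr 1); apply: SB. Qed.

Lemma is_subring_int (R : pzRingType) (S : set R) : is_subring S ->
  forall k : int, S k%:~R.
Proof.
move=> SS; have [S1 SB _] := SS; have S0 := is_subring0 SS.
have Sn n : S n%:R.
  by elim: n => // n IH; rewrite -addn1 natrD; apply: is_subringD.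
case=> n; first exact: Sn.
by rewrite NegzE rmorphN /= -sub0r; apply: SB; [exact: S0|exact: Sn].
Qed.

Lemma is_subringX (R : pzRingType) (S : set R) : is_subring S ->
  forall x n, S x -> S (x ^+ n).
Proof.
by case=> S1 _ SM x n Sx; elim: n => [|n IH]; rewrite ?expr0 ?exprS //; apply: SM.
Qed.

Lemma is_ideal0 (R : pzRingType) (I : set R) : is_ideal I -> I 0.
Proof. by case=> -[]. Qed.

Lemma is_idealB (R : pzRingType) (I : set R) : is_ideal I ->
  forall x y, I x -> I y -> I (x - y).
Proof. by case=> -[]. Qed.

Lemma is_idealD (R : pzRingType) (I : set R) : is_ideal I ->
  forall x y, I x -> I y -> I (x + y).
Proof.
move=> hI x y Ix Iy; rewrite -[y]opprK -[- y]sub0r.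
by do !apply: (is_idealB hI) => //; apply: is_ideal0.
Qed.

Lemma is_idealMl (R : pzRingType) (I : set R) : is_ideal I ->
  forall a x, I x -> I (a * x).
Proof. by case=> _ h a x Ix; case: (h a x Ix). Qed.

Lemma is_idealMr (R : pzRingType) (I : set R) : is_ideal I ->
  forall a x, I x -> I (x * a).
Proof. by case=> _ h a x Ix; case: (h a x Ix). Qed.

(** Since b f lies in f R, the right ideal f R also absorbs left multiplication. This supplies the
    principal ideals e R, p R and a^2 R to which minimality is later applied. *)
Lemma is_ideal_normal (R : pzRingType) (f : R) :
  (forall b, exists b', b * f = f * b') -> is_ideal [set f * r | r in [set: R]].
Proof.
move=> cf; split; first split.
- by exists 0; rewrite ?mulr0.
- by move=> _ _ [r _ <-] [t _ <-]; exists (r - t); rewrite ?mulrBr.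
- move=> b _ [r _ <-]; split; last by exists (r * b); rewrite ?mulrA.
  by have [b' E] := cf b; exists (b' * r) => //; rewrite !mulrA E.
Qed.

Lemma gen_ideal_sub (R : pzRingType) (A : set R) : A `<=` gen_ideal A.
Proof. by move=> x Ax B [_]; apply. Qed.

Definition noncommutative (R : pzRingType) : Prop :=
  exists x y : R, x * y <> y * x.

Definition generated_by_noncommuting (R : pzRingType) : Prop :=
  forall S : set R, is_subring S ->
    (exists x y, [/\ S x, S y & x * y <> y * x]) -> forall z, S z.

Definition commutators_in_ideals (R : pzRingType) : Prop :=
  forall I : set R, is_ideal I -> (exists2 x, I x & x <> 0) ->
    forall x y, I (x * y - y * x).

(** Both conditions are contrapositives: a subring with a noncommuting pair cannot be proper, and
    R/I is commutative exactly when I contains every commutator. *)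
Lemma minimal_noncommutativeE (R : pzRingType) :
  minimal_noncommutative R <->
  [/\ noncommutative R, generated_by_noncommuting R & commutators_in_ideals R].
Proof.
split=> -[nc hS hI]; split.
- apply: contrapT => h; apply: nc => x y; apply: contrapT => xy.
  by apply: h; exists x, y.
- move=> S [S1 SB SM] [x [y [Sx Sy xy]]] z; apply: contrapT => nSz.
  pose P : {pred R} := fun u => `[< S u >].
  have PP u : S u -> u \in P by move=> Su; apply/asboolP.
  apply: xy; apply: (hS P); rewrite ?PP //; last first.
    by exists z; apply/negP => /asboolP.
  split=> [|u v /asboolP Su /asboolP Sv|u v /asboolP Su /asboolP Sv].
  + exact: PP.
  + exact/PP/SB.
  + exact/PP/SM.
- move=> I iI nzI x y; have /= h := hI (Ideal iI) nzI.
  apply/(@quot_eqP R (Ideal iI)); rewrite -!(@quot_piM R (Ideal iI)); exact: h.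
- by case: nc => x [y xy] /(_ x y).
- move=> S [S1 SB SM] [z zS] x y Sx Sy; apply: contrapT => xy.
  move/negP: zS; apply; apply: (hS (fun u => u \in S)); last by exists x, y.
  by split.
- move=> I nzI u v; rewrite -[u]reprK -[v]reprK.
  change (quot_mul (\pi_(quot_ring I) (repr u)) (\pi_(quot_ring I) (repr v)) =
   quot_mul (\pi_(quot_ring I) (repr v)) (\pi_(quot_ring I) (repr u))).
  rewrite !quot_piM; apply/quot_eqP; apply: hI => //; exact: ideal_setP.
Qed.

Lemma ring_iso_sym (R S : pzRingType) : ring_iso R S -> ring_iso S R.
Proof.
move=> [f [g fK gK]]; have finj := can_inj fK.
have gB : zmod_morphism g.
  by move=> x y; apply: finj; rewrite rmorphB !gK.
have gM : monoid_morphism g.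
  by split=> [|x y]; apply: finj; rewrite ?rmorph1 ?rmorphM !gK.
pose ga := GRing.isZmodMorphism.Build _ _ g gB.
pose gm := GRing.isMonoidMorphism.Build _ _ g gM.
by exists (HB.pack_for {rmorphism S -> R} g ga gm); exists f.
Qed.

Lemma ring_iso_trans (R S T : pzRingType) :
  ring_iso R S -> ring_iso S T -> ring_iso R T.
Proof.
by move=> [f bf] [g bg]; exists (g \o f : {rmorphism R -> T}); apply: bij_comp.
Qed.

Lemma minimal_noncommutative_iso (R S : pzRingType) :
  ring_iso R S -> minimal_noncommutative R -> minimal_noncommutative S.
Proof.
move=> [f [g fK gK]] /minimal_noncommutativeE[[x [y xy]] hS hI].
have finj := can_inj fK; apply/minimal_noncommutativeE; split.
- by exists (f x), (f y); rewrite -!rmorphM => /finj.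
- move=> T [T1 TB TM] [u [v [Tu Tv uv]]] z; rewrite -(gK z).
  apply: (hS (fun r => T (f r))).
    split=> [|a b Ta Tb|a b Ta Tb]; first by rewrite rmorph1.
      by rewrite rmorphB; apply: TB.
    by rewrite rmorphM; apply: TM.
  exists (g u), (g v); split; rewrite ?gK // => /(congr1 f).
  by rewrite !rmorphM !gK.
- move=> I iI [u Iu nzu] a b.
  rewrite -(gK a) -(gK b) -!rmorphM -rmorphB; apply: (hI (fun r => I (f r))).
    split; first split.
    + by rewrite rmorph0; apply: is_ideal0.
    + by move=> c d Ic Id; rewrite rmorphB; apply: is_idealB.
    + by move=> c d Id; rewrite !rmorphM; split; [apply: is_idealMl|apply: is_idealMr].
  by exists (g u); rewrite ?gK // => g0; apply: nzu; rewrite -(gK u) g0 rmorph0.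
Qed.

Lemma finite_surj (T U : Type) (f : T -> U) :
  (forall u, exists t, f t = u) -> finite_set [set: T] -> finite_set [set: U].
Proof.
move=> fS fin; apply: (sub_finite_set _ (finite_image f fin)) => u _.
by have [t <-] := fS u; exists t.
Qed.

(** Every element is an integer combination of words, and every word is a product of letters. *)
Lemma free_ind (S : set freeZ2) : is_subring S -> S fx -> S fy -> forall z, S z.
Proof.
move=> SS Sx Sy z; have [S1 SB SM] := SS; have SD := is_subringD SS.
have E (c : int) (m : {fmonom bool}) :
    (<< c *g m >> : {malg int[{fmonom bool}]}) = c%:~R * << m >>.
  by rewrite mulrzl -raddfMz /= intz.
rewrite [z](@monalgE {fmonom bool} int); elim/big_ind: _ => //.
  exact: is_subring0.
move=> m _; rewrite E; apply: (SM); first exact: (is_subring_int SS).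
rewrite -(fmK m); elim: (fmonom_val m) => [|b s IH].
  by rewrite -fmoneE.
have -> : (<< FMonom (b :: s) >> : {malg int[{fmonom bool}]}) =
    << fmu b >> * << FMonom s >>.
  by rewrite malgM_def fgmulUU mul1r /= /mmul /= fmmulE fmuE.
by apply: SM => //; case: b.
Qed.

(** A word goes to the product of the images of its letters; the additive extension is
    multiplicative because integers are central in R. *)
Lemma free_eval (R : nzRingType) (x y : R) :
  exists f : {rmorphism freeZ2 -> R}, f fx = x /\ f fy = y.
Proof.
pose h (m : {fmonom bool}) : R := \prod_(b <- fmonom_val m) (if b then x else y).
have hM : mmorphism h.
  split=> [a b|]; first by rewrite /h fmM big_cat.
  by rewrite /h fm1 big_nil.
pose hm : {mmorphism {fmonom bool} -> R} := HB.pack h (isMultiplicative.Build _ _ h hM).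
have cf (g : {malg int[{fmonom bool}]}) m m' :
  GRing.comm (intr g@_m) (hm m') by exact/commr_sym/commr_int.
have eM := @commr_mmap_is_multiplicative _ _ _ (intr : {rmorphism int -> R}) hm cf.
pose ev : {malg int[{fmonom bool}]} -> R := mmap intr hm.
have eB : zmod_morphism ev by move=> a b; rewrite /ev raddfB.
have eM' : monoid_morphism ev by case: eM.
pose f : {rmorphism {malg int[{fmonom bool}]} -> R} :=
  HB.pack ev (GRing.isZmodMorphism.Build _ _ ev eB)
    (GRing.isMonoidMorphism.Build _ _ ev eM').
exists f; rewrite /f /= /ev /fx /fy !mmapU /= /h !fmU !big_seq1.
by rewrite !mul1r.
Qed.

(** * Quotients of the free ring on two generators *)

Lemma quot_pi_rmorphism (R : pzRingType) (I : ideal R) :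
  exists f : {rmorphism R -> quot_ring I}, forall x, f x = \pi_(quot_ring I) x.
Proof.
pose g (x : R) := \pi_(quot_ring I) x.
have gB : zmod_morphism g.
  move=> x y; rewrite /g -[RHS]/(_ + - \pi_(quot_ring I) y).
  by apply: (addIr (\pi_(quot_ring I) y)); rewrite quot_piD !subrK.
have gM : monoid_morphism g by split=> // x y; rewrite /g -quot_piM.
by exists (HB.pack_for {rmorphism R -> quot_ring I} g
  (GRing.isZmodMorphism.Build _ _ g gB) (GRing.isMonoidMorphism.Build _ _ g gM)).
Qed.

Lemma quot_lift (A R : pzRingType) (I : ideal A) (h : {rmorphism A -> R}) :
  (forall x, ideal_set I x -> h x = 0) ->
  exists f : {rmorphism quot_ring I -> R}, forall x, f (\pi_(quot_ring I) x) = h x.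
Proof.
move=> h0; pose g (u : quot_ring I) := h (repr u).
have [q qE] := quot_pi_rmorphism I.
have gpi x : g (\pi_(quot_ring I) x) = h x.
  apply/eqP; rewrite -subr_eq0 -rmorphB h0 //; apply/quot_eqP.
  by rewrite reprK.
have gB : zmod_morphism g.
  by move=> u v; rewrite -[u]reprK -[v]reprK -!qE -rmorphB !qE !gpi rmorphB.
have gM : monoid_morphism g.
  split; first by rewrite -(rmorph1 q) qE gpi rmorph1.
  by move=> u v; rewrite -[u]reprK -[v]reprK -!qE -rmorphM !qE !gpi rmorphM.
by exists (HB.pack_for {rmorphism quot_ring I -> R} g
  (GRing.isZmodMorphism.Build _ _ g gB) (GRing.isMonoidMorphism.Build _ _ g gM)).
Qed.

(** Integers commute past x and y, so Z + x R + y R is closed under products. *)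
Lemma mul_int_combination (R : pzRingType) (k l : int) (x y a b c d : R) :
  (k%:~R + x * a + y * b) * (l%:~R + x * c + y * d) =
  (k * l)%:~R + x * (k%:~R * c + a * (l%:~R + x * c + y * d))
              + y * (k%:~R * d + b * (l%:~R + x * c + y * d)).
Proof.
have kC (z : R) : k%:~R * z = z * k%:~R by exact/esym/commr_int.
set u := l%:~R + _ + _; rewrite !mulrDl {1}/u !mulrDr rmorphM /= -!mulrA.
rewrite (mulrA k%:~R x) (kC x) (mulrA k%:~R y) (kC y) -!mulrA.
by rewrite !addrA; do 3!congr (_ + _); rewrite 3!(addrAC _ (y * (k%:~R * d))).
Qed.

Section TwoGenerated.
Variables (F : pzRingType) (x y : F) (p : nat).
Hypothesis F_gen : forall S : set F, is_subring S -> S x -> S y -> forall z, S z.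
Local Notation J := (gen_ideal [set p%:R; x; y]).

Lemma gen_pxy_ideal : is_ideal J. Proof. exact: gen_ideal_ideal. Qed.
Lemma gen_pxy_p : J p%:R. Proof. by apply: gen_ideal_sub; left; left. Qed.
Lemma gen_pxy_x : J x. Proof. by apply: gen_ideal_sub; left; right. Qed.
Lemma gen_pxy_y : J y. Proof. by apply: gen_ideal_sub; right. Qed.

(** Both generators vanish modulo J, so the quotient by J is an image of Z. *)
Lemma int_mod_gen_pxy z : exists k : int, J (z - k%:~R).
Proof.
have iJ := gen_pxy_ideal.
apply: (F_gen (S := fun z => exists k : int, J (z - k%:~R))).
- split.
  + by exists 1; rewrite subrr; apply: is_ideal0.
  + move=> a b [k Jk] [l Jl]; exists (k - l).
    rewrite rmorphB /= opprB addrACA [- b - _]addrC -addrACA -[l%:~R - b]opprB.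
    exact: (is_idealB iJ).
  + move=> a b [k Jk] [l Jl]; exists (k * l); rewrite rmorphM /=.
    have -> : a * b - k%:~R * l%:~R =
        a * (b - l%:~R) + (a - k%:~R) * l%:~R.
      by rewrite mulrBr mulrBl addrA subrK.
    by apply: (is_idealD iJ); [exact: (is_idealMl iJ)|exact: (is_idealMr iJ)].
- by exists 0; rewrite subr0; apply: gen_pxy_x.
- by exists 0; rewrite subr0; apply: gen_pxy_y.
Qed.

Lemma ideal_pow_exp z n : J z -> ideal_pow J n (z ^+ n).
Proof.
by move=> Jz; elim: n => // n IH; rewrite exprS; apply: set_prod_mem.
Qed.

Lemma pxy_decomposition z : (0 < p)%N -> exists (k : nat) z1 z2 z3,
  (k < p)%N /\ z = k%:R + p%:R * z1 + x * z2 + y * z3.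
Proof.
move=> p_gt0.
have [k [z2 [z3 ->]]] :
    exists (k : int) z2 z3, z = k%:~R + x * z2 + y * z3.
  apply: (F_gen (S := fun z => exists (k : int) z2 z3,
                            z = k%:~R + x * z2 + y * z3)).
  - split.
    + by exists 1, 0, 0; rewrite !mulr0 !addr0.
    + move=> _ _ [k [a [b ->]]] [l [c [d ->]]].
      exists (k - l), (a - c), (b - d); rewrite rmorphB !mulrBr /=.
      by rewrite !opprD addrACA (addrACA k%:~R).
    + move=> _ _ [k [a [b ->]]] [l [c [d ->]]].
      by rewrite mul_int_combination; eexists _, _, _.
  - by exists 0, 1, 0; rewrite mulr1 mulr0 addr0 add0r.
  - by exists 0, 0, 1; rewrite mulr1 mulr0 addr0 add0r.
(* The integer part k is divided by p with remainder; the quotient becomes the coefficient of p. *)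
exists `|(k %% p)%Z|%N, (k %/ p)%Z%:~R, z2, z3.
have pz : (p != 0 :> int) by rewrite -lt0n.
split; first by rewrite -ltz_nat gez0_abs ?modz_ge0 // ltz_pmod.
congr (_ + _ + _); rewrite !pmulrn gez0_abs ?modz_ge0 // -rmorphM -rmorphD; congr (_%:~R).
by rewrite {1}(divz_eq k p) addrC mulrC.
Qed.

(** Induction on n: in k + p z1 + x z2 + y z3 with k < p, replacing each zi by a representative
    modulo J^n changes the sum by an element of J^(n+1). *)
Lemma finite_mod_ideal_pow n : (0 < p)%N ->
  exists s : seq F, forall z, exists2 l, l \in s & ideal_pow J n (z - l).
Proof.
move=> p_gt0; elim: n => [|n [s hs]]; first by exists [:: 0] => z; exists 0; rewrite ?inE.
exists [seq k%:R + p%:R * a.1.1 + x * a.1.2 + y * a.2 |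
   k <- iota 0 p, a <- [seq (b, c) | b <- [seq (d, e) | d <- s, e <- s], c <- s]].
move=> z; have [k [z1 [z2 [z3 [kp ->]]]]] := pxy_decomposition z p_gt0.
have [a1 s1 h1] := hs z1; have [a2 s2 h2] := hs z2; have [a3 s3 h3] := hs z3.
exists (k%:R + p%:R * a1 + x * a2 + y * a3).
  apply/allpairsP; exists (k, (a1, a2, a3)); split=> //=.
    by rewrite mem_iota.
  by do 2!(apply: allpairs_f => //).
have iJ := ideal_pow_ideal n.+1 gen_pxy_ideal.
rewrite !opprD addrACA (addrACA (k%:R + _)) (addrACA k%:R) subrr add0r -!mulrBr.
apply: (is_idealD iJ); first apply: (is_idealD iJ); apply: set_prod_mem => //.
- exact: gen_pxy_p.
- exact: gen_pxy_x.
- exact: gen_pxy_y.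
Qed.

End TwoGenerated.

(** * Finiteness and locality of the images of A *)

Lemma image_A_ringP (p n : nat) (R : pzRingType) :
  homomorphic_image (A_ring p n) R <->
  exists h : {rmorphism freeZ2 -> R},
    (forall r, exists z, h z = r) /\ forall z, A_rel p n z -> h z = 0.
Proof.
pose I := Ideal (A_rel_ideal p n).
split=> [[f fS]|[h [hS h0]]].
  have [q qE] := quot_pi_rmorphism I.
  exists (f \o q : {rmorphism freeZ2 -> R}); split=> [r|z Az] /=.
    by have [a <-] := fS r; exists (repr a); rewrite qE reprK.
  have -> : q z = q 0 by rewrite !qE; apply/quot_eqP; rewrite subr0.
  by rewrite !rmorph0.
have [f fE] := quot_lift (I := I) h0.
by exists f => r; have [z <-] := hS r; exists (\pi_(quot_ring I) z).
Qed.

(** Isolates the consequence of the relations that yields finiteness and locality: the n-th power of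
    (p,x,y) is killed. *)
Lemma class_A_free (R : pzRingType) : class_A R -> exists p n,
  exists h : {rmorphism freeZ2 -> R}, [/\ prime p, forall r, exists z, h z = r
   & forall z, ideal_pow (pxy p) n z -> h z = 0].
Proof.
case=> p [n [pr_p _ _ /image_A_ringP[h [hS h0]]]].
exists p, n, h; split=> // z Jz; apply: h0; exists 0.
  exists 0; first exact: (set_prod_subgroup _ _).1.
  by exists 0; rewrite ?addr0 //; exact: (set_prod_subgroup _ _).1.
by exists z; rewrite ?add0r.
Qed.

Lemma class_A_finite (R : pzRingType) : class_A R -> finite_set [set: R].
Proof.
move=> /class_A_free[p [n [h [pr_p hS h0]]]].
have [s hs] := finite_mod_ideal_pow free_ind n (prime_gt0 pr_p).
apply/finite_seqP; exists [seq h z | z <- s]; apply/seteqP; split=> // r _ /=.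
have [z <-] := hS r; have [l ls /h0/eqP] := hs z.
by rewrite rmorphB subr_eq0 => /eqP->; apply: map_f.
Qed.

Lemma class_A_local (R : pzRingType) : class_A R ->
  forall r : R, exists (k : int) (n : nat), (r - k%:~R) ^+ n = 0.
Proof.
move=> /class_A_free[p [n [h [pr_p hS h0]]]] r; have [z <-] := hS r.
have [k Jk] := int_mod_gen_pxy p free_ind z; exists k, n.
by rewrite -(rmorph_int h) -rmorphB -rmorphXn h0 //; apply: ideal_pow_exp.
Qed.

(** * Finite fields *)

(** Let r = e mod d. Modulo p^d - 1 one has p^d = 1, hence p^e = p^r; so p^d - 1 divides the smaller
    number p^r - 1, which forces r = 0. *)
Lemma expn_sub1_dvd p d e : (1 < p)%N -> ((p ^ d).-1 %| (p ^ e).-1)%N -> (d %| e)%N.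
Proof.
move=> p_gt1; have p_gt0 := ltnW p_gt1.
have [->|d_gt0] := posnP d.
  rewrite expn0 /= !dvd0n -subn1 subn_eq0 -[X in (_ <= X)%N](expn0 p).
  by rewrite leq_exp2l // leqn0.
move=> dv; have pd_gt1 : (1 < p ^ d)%N by rewrite -{1}(expn0 p) ltn_exp2l.
have pd1 : (p ^ d = 1 %[mod (p ^ d).-1])%N.
  by rewrite -{1}(ltn_predK pd_gt1) -addn1 modnDl.
have E : (p ^ e = p ^ (e %% d) %[mod (p ^ d).-1])%N.
  rewrite {1}(divn_eq e d) expnD [(_ %/ d * d)%N]mulnC expnM -modnMml -modnXm pd1 modnXm.
  by rewrite exp1n modnMml mul1n.
have lt : (p ^ (e %% d) < p ^ d)%N by rewrite ltn_exp2l // ltn_mod.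
have dv' : ((p ^ d).-1 %| (p ^ (e %% d)).-1)%N.
  have H a : (0 < a)%N -> ((p ^ d).-1 %| a.-1)%N = (a == 1 %[mod (p ^ d).-1])%N.
    by move=> a0; rewrite eqn_mod_dvd // subn1.
  by move: dv; rewrite !H ?expn_gt0 ?p_gt0 // E.
have : (p ^ (e %% d)).-1 = 0%N.
  apply/eqP; rewrite -[_ == _]negbK -lt0n; apply/negP => gt0.
  have := dvdn_leq gt0 dv'; rewrite leqNgt => /negP; apply.
  by rewrite -!subn1 ltn_sub2r.
move/eqP; rewrite -subn1 subn_eq0 -[X in (_ <= X)%N](expn0 p) leq_exp2l //.
by rewrite leqn0.
Qed.

(** If distinct primes r and q divided k, then lcm(k/r, k/q) = k would divide e, although 0 < e < k.
    So k is a power of one prime q, and j is the quotient of e by k/q. *)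
Lemma prime_power_of_divisors k e : (0 < e < k)%N ->
  (forall d, (d %| k)%N -> (d < k)%N -> (d %| e)%N) ->
  exists q m j, [/\ prime q, (1 <= m)%N, (1 <= j <= q - 1)%N, k = (q ^ m)%N
    & e = (j * q ^ (m - 1))%N].
Proof.
move=> /andP[e_gt0 e_lt] h; have k_gt1 : (1 < k)%N := leq_ltn_trans e_gt0 e_lt.
have k_gt0 := ltnW k_gt1; pose q := pdiv k.
have pr_q : prime q by apply: pdiv_prime.
have q_gt1 := prime_gt1 pr_q.
have divlt r : prime r -> (r %| k)%N -> (k %/ r %| e)%N.
  by move=> pr_r rk; apply: h; [apply: dvdn_div|apply: ltn_Pdiv => //; apply: prime_gt1].
have only_q r : prime r -> (r %| k)%N -> r = q.
  move=> pr_r rk; apply/eqP/negPn/negP => rq.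
  suff : (k %| e)%N by move/(dvdn_leq e_gt0); rewrite leqNgt e_lt.
  have : (lcmn (k %/ r) (k %/ q) %| e)%N by rewrite dvdn_lcm !divlt ?pdiv_dvd.
  apply: dvdn_trans; have qk := pdiv_dvd k.
  have rqk : (r * q %| k)%N by rewrite Gauss_dvd ?rk ?qk // prime_coprime // dvdn_prime2.
  case/dvdnP: rqk => c kE.
  have cr : (k %/ r = c * q)%N by rewrite kE mulnCA mulKn ?prime_gt0.
  have cq : (k %/ q = c * r)%N by rewrite kE mulnA mulnK ?prime_gt0.
  rewrite cr cq -muln_lcmr lcmnC; have /eqP : coprime r q.
    by rewrite prime_coprime // dvdn_prime2.
  by move=> co; rewrite /lcmn co divn1 -kE.
have kq : k = (q ^ logn q k)%N.
  have : q.-nat k.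
    by apply/pnatP => // r pr_r rk; rewrite inE (only_q r).
  by rewrite -p_part => /part_pnat_id->.
have m_gt0 : (0 < logn q k)%N by rewrite logn_gt0 mem_primes pr_q k_gt0 pdiv_dvd.
have /dvdnP[j ej] : (k %/ q %| e)%N by apply: divlt => //; apply: pdiv_dvd.
have kq1 : (k %/ q = q ^ (logn q k - 1))%N.
  by rewrite {1}kq -{1}(prednK m_gt0) expnS mulKn ?prime_gt0 // subn1.
exists q, (logn q k), j; split=> //; last by rewrite -kq1.
move: e_gt0 e_lt; rewrite ej muln_gt0 => /andP[j_gt0 kq_gt0] jlt.
rewrite j_gt0 -ltnS subn1 prednK ?prime_gt0 //=.
by rewrite -(ltn_pmul2r kq_gt0) [X in (_ < X)%N]mulnC divnK ?pdiv_dvd.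
Qed.

Lemma Fp_to_ring (R : pzRingType) (p : nat) : prime p -> p%:R = 0 :> R ->
  exists i : {rmorphism 'F_p -> R}, forall a, i a = (a : nat)%:R.
Proof.
move=> pr_p p0; pose g (a : 'F_p) : R := (a : nat)%:R.
have gmod n : (n %% (Zp_trunc (pdiv p)).+2)%:R = n%:R :> R.
  by rewrite Fp_cast // [in RHS](divn_eq n p) natrD natrM p0 mulr0 add0r.
have gD a b : g (a + b) = g a + g b by rewrite /g /= gmod natrD.
have gB : zmod_morphism g.
  by move=> a b; apply: (addIr (g b)); rewrite -gD !subrK.
have gM : monoid_morphism g.
  by split=> [|a b]; rewrite /g /= gmod // natrM.
by exists (HB.pack_for {rmorphism 'F_p -> R} g
  (GRing.isZmodMorphism.Build _ _ g gB) (GRing.isMonoidMorphism.Build _ _ g gM)).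
Qed.

Section FiniteField.
Variables (F : finFieldType) (p k : nat).
Hypotheses (pF : p \in [pchar F]) (cF : #|F| = (p ^ k)%N).
Local Notation Frob := (pFrobenius_aut pF).

Let pr_p : prime p := pcharf_prime pF.
Let p_gt1 : (1 < p)%N := prime_gt1 pr_p.

Lemma finField_exponent_gt0 : (0 < k)%N.
Proof. by have := finNzRing_gt1 F; rewrite cF -{1}(expn0 p) ltn_exp2l. Qed.

Lemma finField_prim_root : exists t : F, (p ^ k).-1.-primitive_root t.
Proof.
have q_gt1 := finNzRing_gt1 F.
have n_gt0 : (0 < (p ^ k).-1)%N by rewrite -ltnS -cF (ltn_predK q_gt1).
pose rs := [seq x <- enum F | x != 0].
suff /hasP[t _ pt] : has (p ^ k).-1.-primitive_root rs by exists t.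
apply: has_prim_root => //.
- apply/allP => x; rewrite mem_filter => /andP[x0 _].
  rewrite unity_rootE; apply/eqP/(mulfI x0).
  by rewrite -exprS -cF (ltn_predK q_gt1) expf_card mulr1.
- by rewrite filter_uniq ?enum_uniq.
- rewrite -cF -(cardC1 (0 : F)) -(card_uniqP _); last by rewrite filter_uniq ?enum_uniq.
  by apply/eq_leq/eq_card => x; rewrite mem_filter mem_enum andbT.
Qed.

Lemma prim_root_finField (t x : F) : (p ^ k).-1.-primitive_root t -> x != 0 ->
  exists i, x = t ^+ i.
Proof.
move=> pt x0; have xn : x ^+ (p ^ k).-1 = 1.
  apply/(mulfI x0); rewrite -exprS -cF (ltn_predK (finNzRing_gt1 F)).
  by rewrite expf_card mulr1.
by have [i ->] := prim_rootP pt xn; exists i.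
Qed.

Lemma exp_pn_mul (x : F) a n : x ^+ (p ^ a) = x -> x ^+ (p ^ (n * a)) = x.
Proof.
move=> xa; elim: n => [|n IH]; rewrite ?expr1 // mulSn expnD exprM xa.
exact: IH.
Qed.

(** By Bezout u a = v b + gcd(a, b); both Frobenius powers p^(u a) and p^(v b) fix x. *)
Lemma exp_pn_gcd (x : F) a b : (0 < a)%N -> x ^+ (p ^ a) = x ->
  x ^+ (p ^ b) = x -> x ^+ (p ^ gcdn a b) = x.
Proof.
move=> a_gt0 xa xb; case: (egcdnP b a_gt0) => u v E _.
have := exp_pn_mul u xa; rewrite E expnD exprM exp_pn_mul //.
Qed.

Lemma exp_pnB (x y : F) n : (x - y) ^+ (p ^ n) = x ^+ (p ^ n) - y ^+ (p ^ n).
Proof.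
elim: n => [|n IH]; first by rewrite !expr1.
by rewrite expnSr !exprM IH -!(pFrobenius_autE pF) rmorphB.
Qed.

Lemma exp_pn_inj n : injective (fun x : F => x ^+ (p ^ n)).
Proof.
move=> x y /=; elim: n => [|n IH]; first by rewrite !expr1.
by rewrite expnSr !exprM -!(pFrobenius_autE pF) => /fmorph_inj/IH.
Qed.

Lemma prim_root_neq0 (t : F) n : n.-primitive_root t -> t != 0.
Proof.
move=> pt; apply: contraTneq isT => t0; have := prim_expr_order pt.
rewrite t0 expr0n gtn_eqF ?(prim_order_gt0 pt) // => /esym/eqP.
by rewrite oner_eq0.
Qed.

Lemma prim_root_exp_pn (t : F) d : (p ^ k).-1.-primitive_root t -> (0 < d < k)%N ->
  t ^+ (p ^ d) <> t.
Proof.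
move=> pt /andP[d_gt0 dk] td.
have pd_gt0 : (0 < p ^ d)%N by rewrite expn_gt0 ltnW.
suff : (k %| d)%N by move/(dvdn_leq d_gt0); rewrite leqNgt dk.
apply: (expn_sub1_dvd p_gt1); rewrite (prim_order_dvd pt).
have t0 := prim_root_neq0 pt.
by apply/eqP/(mulfI t0); rewrite -exprS prednK // td mulr1.
Qed.

Lemma Fp_embedding :
  exists i : {rmorphism 'F_p -> F}, forall a, i a = (a : nat)%:R.
Proof. exact: Fp_to_ring pr_p (pcharf0 pF). Qed.

Lemma Fp_exp (a : 'F_p) : a ^+ p = a.
Proof. by have := expf_card a; rewrite card_Fp. Qed.

(** The p elements of the image of ['F_p] are roots of X^p - X; a further root c would exceed its
    degree. *)
Lemma Fp_embeddingP (i : {rmorphism 'F_p -> F}) (c : F) :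
  c ^+ p = c -> exists a, i a = c.
Proof.
move=> cp; apply: contrapT => nc.
pose rs := c :: [seq i a | a <- enum 'F_p].
pose f : {poly F} := 'X^p - 'X.
have sz : size f = p.+1.
  by rewrite size_polyDl size_polyXn // size_polyN size_polyX.
have nz : f != 0 by rewrite -size_poly_gt0 sz.
have : (size rs < size f)%N.
  apply: max_poly_roots nz _ _.
    rewrite /= {1}/root !hornerE cp subrr eqxx /=.
    apply/allP => _ /mapP[a _ ->]; rewrite /root !hornerE -rmorphXn /=.
    by rewrite Fp_exp subrr.
  rewrite /= map_inj_uniq ?enum_uniq ?andbT; last exact: fmorph_inj.
  by apply/negP => /mapP[a _ ca]; apply: nc; exists a.
by rewrite sz /= size_map -cardE card_Fp // ltnn.
Qed.

Lemma Fp_embedding_exp (i : {rmorphism 'F_p -> F}) a n : i a ^+ (p ^ n) = i a.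
Proof.
rewrite -rmorphXn; congr (i _); elim: n => [|n IH]; first by rewrite expr1.
by rewrite expnSr exprM IH Fp_exp.
Qed.

Lemma horner_Fp_exp (i : {rmorphism 'F_p -> F}) (g : {poly 'F_p}) (x : F) n :
  (map_poly i g).[x ^+ (p ^ n)] = (map_poly i g).[x] ^+ (p ^ n).
Proof.
elim: n => [|n IH]; first by rewrite !expr1.
rewrite expnSr !exprM -IH -!(pFrobenius_autE pF).
rewrite -horner_map /= -map_poly_comp; congr (_.[_]).
by apply: eq_map_poly => a /=; rewrite pFrobenius_autE; apply/esym/(Fp_embedding_exp i a 1).
Qed.

(** The Galois orbit of x over the prime field, always with k entries, hence with repetitions when x
    lies in a proper subfield. *)
Definition conjugates (x : F) := [seq x ^+ (p ^ j) | j <- index_iota 0 k].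

Lemma uniq_conjugates (x : F) :
  (forall d, (0 < d < k)%N -> x ^+ (p ^ d) <> x) -> uniq (conjugates x).
Proof.
move=> hx; rewrite map_inj_in_uniq ?iota_uniq // => a b.
rewrite !mem_index_iota => /andP[_ ak] /andP[_ bk].
wlog ab : a b ak bk / (a <= b)%N.
  by move=> W; case/orP: (leq_total a b) => ab h; [|apply/esym]; apply: W.
move=> h; apply/eqP; rewrite eqn_leq ab leqNgt; apply/negP => lt.
apply: (hx (b - a)%N); first by rewrite subn_gt0 lt (leq_ltn_trans (leq_subr _ _)).
by apply: (@exp_pn_inj a); rewrite -exprM -expnD subnK.
Qed.

(** Frobenius fixes the coefficients, so a root x of g makes all k distinct conjugates of x roots,
    too many for degree below k. *)
Lemma horner_Fp_inj (i : {rmorphism 'F_p -> F}) (x : F) (g : {poly 'F_p}) :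
  (forall d, (0 < d < k)%N -> x ^+ (p ^ d) <> x) -> (size g <= k)%N ->
  (map_poly i g).[x] = 0 -> g = 0.
Proof.
move=> hx sg gx; apply/eqP; rewrite -(map_poly_eq0 i); apply: contraT => nz.
have : (size (conjugates x) < size (map_poly i g))%N.
  apply: max_poly_roots => //; last exact: uniq_conjugates.
  apply/allP => _ /mapP[j _ ->]; rewrite /root horner_Fp_exp gx expr0n.
  by rewrite gtn_eqF // expn_gt0 ltnW.
by rewrite size_map size_iota subn0 size_map_poly ltnNge sg.
Qed.

(** Counting: evaluation at x is injective on the p^k polynomials of degree below k, and F has p^k
    elements. *)
Lemma horner_Fp_surj (i : {rmorphism 'F_p -> F}) (x : F) :
  (forall d, (0 < d < k)%N -> x ^+ (p ^ d) <> x) ->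
  forall z, exists g : {poly 'F_p}, (map_poly i g).[x] = z.
Proof.
(* The default 0 is never reached, because the coefficients run over j < k. *)
move=> hx; pose P (f : {ffun 'I_k -> 'F_p}) : {poly 'F_p} :=
  \poly_(j < k) (if insub j is Some u then f u else 0).
pose h f := (map_poly i (P f)).[x].
have hinj : injective h.
  move=> f g /eqP; rewrite -subr_eq0 -hornerN -hornerD -rmorphB => /eqP h0.
  have : P f - P g = 0.
    apply: (horner_Fp_inj hx) h0; rewrite (leq_trans (size_polyD _ _)) //.
    by rewrite geq_max size_polyN !size_poly.
  move=> /eqP; rewrite subr_eq0 => /eqP E; apply/ffunP => u.
  have := congr1 (fun q : {poly 'F_p} => q`_u) E.
  by rewrite !coef_poly ltn_ord valK.
have [|h' _ hK] := inj_card_bij hinj.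
  by rewrite card_ffun card_Fp // card_ord cF.
by move=> z; exists (P (h' z)); rewrite -/(h _) hK.
Qed.

Lemma subring_generated (x : F) (S : set F) : is_subring S -> S x ->
  (forall d, (0 < d < k)%N -> x ^+ (p ^ d) <> x) -> forall z, S z.
Proof.
move=> SS Sx hx z; have [S1 SB SM] := SS; have [i iE] := Fp_embedding.
have [g <-] := horner_Fp_surj i hx z.
rewrite horner_coef; elim/big_ind: _ => [||j _]; first exact: is_subring0.
  exact: is_subringD.
rewrite coef_map /= iE; apply: SM; last exact: is_subringX.
exact: (is_subring_int SS (nat_of_ord _)).
Qed.

End FiniteField.

Section ConjugatesPoly.
Variables (F : finFieldType) (p k : nat).
Hypotheses (pF : p \in [pchar F]) (cF : #|F| = (p ^ k)%N).
Variable i : {rmorphism 'F_p -> F}.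

(** Frobenius permutes the factors cyclically, the last returning to the first because x^(p^k) = x.
    The coefficients are therefore Frobenius-fixed and come from ['F_p]. *)
Lemma conjugates_poly (x : F) : exists g : {poly 'F_p},
  map_poly i g = \prod_(z <- conjugates p k x) ('X - z%:P).
Proof.
set P := \prod_(z <- _) _; have k_gt0 := finField_exponent_gt0 pF cF.
have PE : map_poly (pFrobenius_aut pF) P = P.
  rewrite rmorph_prod /=.
  under eq_bigr do rewrite rmorphB /= map_polyX map_polyC /=.
  rewrite /P !big_map !big_mkord -(prednK k_gt0) big_ord_recr [RHS]big_ord_recl mulrC /=; congr (_ * _).
    by apply: eq_bigr => j _; rewrite pFrobenius_autE -exprM -expnSr.
  by rewrite pFrobenius_autE -exprM -expnSr prednK // -cF expf_card.
have /choice[h hE] : forall c : F, exists a, c ^+ p = c -> i a = c.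
  move=> c; have [cp|nc] := pselect (c ^+ p = c); last by exists 0.
  by have [a <-] := Fp_embeddingP pF i cp; exists a.
exists (\poly_(j < size P) h P`_j); apply/polyP => j.
rewrite coef_map coef_poly /=; case: ltnP => [_|sj]; last by rewrite rmorph0 nth_default.
by apply: hE; rewrite -[in RHS]PE coef_map /= pFrobenius_autE.
Qed.

End ConjugatesPoly.

(** For a primitive root t, s(t) is again a root of the conjugate polynomial of t, whose
    coefficients s fixes; so s(t) = t^(p^e). The powers of t exhaust the nonzero elements. *)
Lemma finField_endo (F : finFieldType) (p k : nat) (s : {rmorphism F -> F}) :
  p \in [pchar F] -> #|F| = (p ^ k)%N ->
  exists2 e, (e < k)%N & forall x, s x = x ^+ (p ^ e).
Proof.
move=> pF cF; have [i iE] := Fp_embedding pF.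
have [t pt] := finField_prim_root cF; have [g gE] := conjugates_poly pF cF i t.
have k_gt0 := finField_exponent_gt0 pF cF.
have : root (map_poly i g) (s t).
  have /eqP : (map_poly i g).[t] = 0.
    apply/eqP; rewrite -/(root _ _) gE root_prod_XsubC.
    by apply/mapP; exists 0%N; rewrite ?mem_index_iota ?expr1.
  rewrite -(fmorph_eq0 s) -horner_map /= -map_poly_comp => h.
  rewrite /root (_ : map_poly i g = map_poly (s \o i) g) //.
  by apply: eq_map_poly => a /=; rewrite iE rmorph_nat.
rewrite gE root_prod_XsubC => /mapP[e]; rewrite mem_index_iota => ek st.
exists e => // x; have [->|x0] := eqVneq x 0.
  by rewrite rmorph0 expr0n gtn_eqF // expn_gt0 prime_gt0 ?(pcharf_prime pF).
have [j ->] := prim_root_finField cF pt x0.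
by rewrite rmorphXn /= st -!exprM mulnC.
Qed.

(** P plays the part of the minimal polynomial of a primitive root t. Once P has a root t' in F',
    the map g(t) -> g(t') is a well-defined embedding, bijective by cardinality. *)
Lemma finField_unique (F F' : finFieldType) (p k : nat) :
  p \in [pchar F] -> p \in [pchar F'] -> #|F| = (p ^ k)%N -> #|F'| = (p ^ k)%N ->
  exists f : {rmorphism F -> F'}, bijective f.
Proof.
move=> pF pF' cF cF'; have [i _] := Fp_embedding pF; have [i' _] := Fp_embedding pF'.
have [t pt] := finField_prim_root cF; have [P PE] := conjugates_poly pF cF i t.
have k_gt0 := finField_exponent_gt0 pF cF; have p_gt1 := prime_gt1 (pcharf_prime pF).
have conj_t d : (0 < d < k)%N -> t ^+ (p ^ d) <> t by apply: (prim_root_exp_pn pF).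
have dvdP (g : {poly 'F_p}) : (map_poly i g).[t] = 0 -> P %| g.
  move=> gt; rewrite -(dvdp_map i) PE uniq_roots_dvdp //.
    apply/allP => _ /mapP[j _ ->]; rewrite /root (horner_Fp_exp pF) gt expr0n.
    by rewrite gtn_eqF // expn_gt0 ltnW.
  by rewrite uniq_rootsE (uniq_conjugates pF).
have sP : size P = k.+1.
  by rewrite -(size_map_poly i) PE size_prod_XsubC size_map size_iota subn0.
(* P divides X^(p^k) - X, which vanishes on all of F'. If P had no root there, its cofactor would
   have p^k roots, more than its degree. *)
have [t' Pt'] : exists t', (map_poly i' P).[t'] = 0.
  have /dvdpP[g gE] : P %| 'X^(p ^ k) - 'X.
    by apply: dvdP; rewrite rmorphB /= map_polyXn map_polyX !hornerE -cF expf_card subrr.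
  apply: contrapT => nt.
  have XE : 'X^(p ^ k) - 'X = map_poly i' g * map_poly i' P.
    by rewrite -rmorphM -gE rmorphB /= map_polyXn map_polyX.
  have sX : size ('X^(p ^ k) - 'X : {poly F'}) = (p ^ k).+1.
    rewrite size_polyDl size_polyXn // size_polyN size_polyX ltnS.
    by rewrite -cF' finNzRing_gt1.
  have X0 : 'X^(p ^ k) - 'X != 0 :> {poly F'} by rewrite -size_poly_gt0 sX.
  have := X0; rewrite XE mulf_eq0 negb_or => /andP[g0 P0].
  have := max_poly_roots g0 _ (enum_uniq F'); rewrite -cardE cF'.
  have -> : all (root (map_poly i' g)) (enum F').
    apply/allP => x _; have /eqP := congr1 (fun q => q.[x]) XE.
    rewrite !hornerE -cF' expf_card subrr eq_sym mulf_eq0 => /orP[//|/eqP h].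
    by case: nt; exists x.
  move=> /(_ isT); have := sX; rewrite XE size_mul // [X in (_ + X)%N]size_map_poly sP.
  rewrite addnS /= => sg; apply/negP; rewrite -leqNgt -ltnS -sg -addn1.
  by rewrite leq_add2l.
have /choice[G GE] := horner_Fp_surj pF cF i conj_t.
pose f z := (map_poly i' (G z)).[t'].
have fE (g : {poly 'F_p}) : f (map_poly i g).[t] = (map_poly i' g).[t'].
  apply/eqP; rewrite /f -subr_eq0 -hornerN -hornerD -rmorphB.
  have /dvdpP[q ->] : P %| G (map_poly i g).[t] - g.
    by apply: dvdP; rewrite rmorphB /= hornerD hornerN GE subrr.
  by rewrite rmorphM hornerM Pt' mulr0.
have fB : zmod_morphism f.
  move=> x y; rewrite -[in LHS](GE x) -[in LHS](GE y) -hornerN -hornerD -rmorphB.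
  by rewrite fE rmorphB hornerD hornerN.
have fM : monoid_morphism f.
  split=> [|x y]; first by have := fE 1; rewrite !rmorph1 !hornerE.
  rewrite -[in LHS](GE x) -[in LHS](GE y) -hornerM -rmorphM.
  by rewrite fE rmorphM hornerM.
pose f' := HB.pack_for {rmorphism F -> F'} f
  (GRing.isZmodMorphism.Build _ _ f fB) (GRing.isMonoidMorphism.Build _ _ f fM).
by exists f'; apply: inj_card_bij; [apply: fmorph_inj|rewrite cF cF'].
Qed.

(** For a proper divisor d of k, take b of order p^d - 1 in the subfield of order p^d. If x ->
    x^(p^e) moved b, that subfield would be all of F. So b is fixed, p^d - 1 divides p^e - 1, and d
    divides e. *)
Lemma fixed_subfields_exponent (F : finFieldType) (p k e : nat) :
  p \in [pchar F] -> #|F| = (p ^ k)%N -> (0 < e < k)%N ->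
  (forall S : set F, is_subring S -> (exists2 x, S x & x ^+ (p ^ e) <> x) ->
     forall z, S z) ->
  exists q m j, [/\ prime q, (1 <= m)%N, (1 <= j <= q - 1)%N, k = (q ^ m)%N
    & e = (j * q ^ (m - 1))%N].
Proof.
move=> pF cF ek hS; apply: prime_power_of_divisors => // d dk d_lt.
have p_gt1 := prime_gt1 (pcharf_prime pF).
have [t pt] := finField_prim_root cF; have t0 := prim_root_neq0 pt.
have d_gt0 : (0 < d)%N by apply: dvdn_gt0 dk; apply: (finField_exponent_gt0 pF cF).
pose S : set F := [set x | x ^+ (p ^ d) = x].
have SS : is_subring S.
  split=> [|x y Sx Sy|x y Sx Sy]; rewrite /S /=; first by rewrite expr1n.
    by rewrite (exp_pnB pF) Sx Sy.
  by rewrite exprMn Sx Sy.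
pose b := t ^+ ((p ^ k).-1 %/ (p ^ d).-1).
have pd : ((p ^ d).-1 %| (p ^ k).-1)%N.
  have dvX a : ((p ^ d).-1 %| ((p ^ d) ^ a).-1)%N.
    by rewrite (predn_exp (p ^ d)) dvdn_mulr.
  by rewrite -(divnK dk) mulnC expnM.
have pd_gt0 : (0 < p ^ d)%N by rewrite expn_gt0 ltnW.
have pb : (p ^ d).-1.-primitive_root b.
  by apply: (dvdn_prim_root pt).
have Sb : S b.
  by rewrite /S /= -[X in b ^+ X](prednK pd_gt0) exprS prim_expr_order ?mulr1.
have be : b ^+ (p ^ e) = b.
  apply: contrapT => nb; have := hS S SS (ex_intro2 _ _ b Sb nb) t.
  by apply: (prim_root_exp_pn pF pt); rewrite d_gt0.
have pe_gt0 : (0 < p ^ e)%N by rewrite expn_gt0 ltnW.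
apply: (expn_sub1_dvd p_gt1); rewrite (prim_order_dvd pb).
by apply/eqP/(mulfI (prim_root_neq0 pb)); rewrite -exprS prednK // be mulr1.
Qed.

(** * The rings U and B *)

Lemma upper_mulmx (R : nzRingType) (M N : 'M[R]_2) : M 1 0 = 0 -> N 1 0 = 0 ->
  [/\ (M * N) 0 0 = M 0 0 * N 0 0, (M * N) 0 1 = M 0 0 * N 0 1 + M 0 1 * N 1 1
    & (M * N) 1 1 = M 1 1 * N 1 1].
Proof.
move=> M0 N0; have l1 : lift ord0 ord0 = 1 :> 'I_2 by exact: val_inj.
split; rewrite !mxE !big_ord_recl !big_ord0 /= !l1 ?M0 ?N0.
- by rewrite mulr0 !addr0.
- by rewrite addr0.
- by rewrite mul0r add0r addr0.
Qed.

Lemma upper_mxP (R : nzRingType) (M N : 'M[R]_2) : M 1 0 = 0 -> N 1 0 = 0 ->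
  M 0 0 = N 0 0 -> M 0 1 = N 0 1 -> M 1 1 = N 1 1 -> M = N.
Proof.
move=> M0 N0 e00 e01 e11; apply/matrixP => i j.
have H (u : 'I_2) : u = 0 \/ u = 1.
  by case: u => [[|[|?]]] // h; [left|right]; apply: val_inj.
by case: (H i) => ->; case: (H j) => ->; rewrite ?M0 ?N0.
Qed.

Section URing.
Variable p : nat.
Local Notation U := (U_ring p).
Implicit Types u v : U.

Definition mkU_mx (a b c : 'F_p) : 'M['F_p]_2 :=
  \matrix_(i, j) if i == 0 then if j == 0 then a else b
                 else if j == 0 then 0 else c.

Lemma mkU_subproof a b c : mkU_mx a b c \in @U_pred p.
Proof. by rewrite unfold_in mxE. Qed.

Definition mkU a b c : U := URing (mkU_subproof a b c).

Lemma U10 u : U_val u 1 0 = 0.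
Proof. by have /eqP := U_valP u. Qed.

Lemma U_eta u : u = mkU (U_val u 0 0) (U_val u 0 1) (U_val u 1 1).
Proof. by apply/val_inj/upper_mxP; rewrite ?U10 ?mxE. Qed.

Lemma mkU_inj a b c a' b' c' : mkU a b c = mkU a' b' c' -> [/\ a = a', b = b' & c = c'].
Proof.
move=> /(congr1 (@U_val p)) /= E.
by split; [have := congr1 (fun M : 'M_2 => M 0 0) E
  |have := congr1 (fun M : 'M_2 => M 0 1) E
  |have := congr1 (fun M : 'M_2 => M 1 1) E]; rewrite /= !mxE.
Qed.

Lemma mkUB a b c a' b' c' : mkU a b c - mkU a' b' c' = mkU (a - a') (b - b') (c - c').
Proof. by rewrite [LHS]U_eta /= !mxE. Qed.

Lemma mkUD a b c a' b' c' : mkU a b c + mkU a' b' c' = mkU (a + a') (b + b') (c + c').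
Proof. by rewrite [LHS]U_eta /= !mxE. Qed.

Lemma mkUM a b c a' b' c' :
  mkU a b c * mkU a' b' c' = mkU (a * a') (a * b' + b * c') (c * c').
Proof.
rewrite [LHS]U_eta /=.
have [-> -> ->] := upper_mulmx (U10 (mkU a b c)) (U10 (mkU a' b' c')).
by rewrite /= !mxE.
Qed.

Lemma mkU1 : (1 : U) = mkU 1 0 1.
Proof. by rewrite [LHS]U_eta /= !mxE. Qed.

Lemma mkU0 : (0 : U) = mkU 0 0 0.
Proof. by rewrite [LHS]U_eta /= !mxE. Qed.

Lemma mkU_nat (n : nat) : n%:R = mkU n%:R 0 n%:R.
Proof.
by elim: n => [|n IH]; [exact: mkU0|rewrite -addn1 !natrD IH mkU1 mkUD addr0].
Qed.

Lemma mkU_int (n : int) : n%:~R = mkU n%:~R 0 n%:~R.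
Proof.
case: n => n; first exact: mkU_nat.
rewrite NegzE !rmorphN /= -[LHS]sub0r mkU0 -[n.+1%:~R]/(n.+1%:R) mkU_nat mkUB.
by rewrite !sub0r oppr0.
Qed.

Lemma U_finite : finite_set [set: U].
Proof.
apply: (@finite_surj ('F_p * 'F_p * 'F_p)%type _ (fun t => mkU t.1.1 t.1.2 t.2)).
  by move=> u; exists (U_val u 0 0, U_val u 0 1, U_val u 1 1); rewrite -U_eta.
exact: finite_finset.
Qed.

Lemma U_minimal_noncommutative : minimal_noncommutative U.
Proof.
apply/minimal_noncommutativeE; split.
- exists (mkU 1 0 0), (mkU 0 1 0); rewrite !mkUM => /mkU_inj[_ /eqP].
  by rewrite !(mul1r, mulr1, mulr0, mul0r, addr0) oner_eq0.
- move=> S SS [u [v [Su Sv uv]]]; have [S1 SB SM] := SS; have SD := is_subringD SS.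
  (* Scalars from ['F_p] are integers, so every subring is an ['F_p]-subspace. *)
  have SZ (n : 'F_p) a b c : S (mkU a b c) -> S (mkU (n * a) (n * b) (n * c)).
    move=> Sm; suff <- : (n : nat)%:R * mkU a b c = mkU (n * a) (n * b) (n * c).
      by apply: (SM) => //; apply: (is_subring_int SS (nat_of_ord _)).
    by rewrite mkU_nat mkUM mul0r addr0 natr_Zp.
  move: u v Su Sv uv => u v; rewrite (U_eta u) (U_eta v).
  move: (U_val u 0 0) (U_val u 0 1) (U_val u 1 1) => a b c.
  move: (U_val v 0 0) (U_val v 0 1) (U_val v 1 1) => a' b' c' Su Sv uv.
  (* The commutator of u and v has zero diagonal and a nonzero corner entry, which can be rescaled
     to any d. *)
  have Se d : S (mkU 0 d 0).
    have := SB _ _ (SM _ _ Su Sv) (SM _ _ Sv Su); rewrite !mkUM mkUB.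
    set w := _ - _; set x := _ - _; set y := _ - _.
    have -> : w = 0 by rewrite /w mulrC subrr.
    have -> : y = 0 by rewrite /y mulrC subrr.
    move/(SZ (d / x)); rewrite mulr0 divfK //; apply: contra_not_neq uv => x0.
    rewrite !mkUM (mulrC a') (mulrC c'); congr mkU; apply/eqP.
    by rewrite -subr_eq0 -/x x0.
  have Sd t : S (mkU t 0 t) by rewrite -[t]mulr1 -(mulr0 t); apply: SZ; rewrite -mkU1.
  (* One of the two elements has distinct diagonal entries, since upper triangular matrices with
     scalar diagonals commute. *)
  have Sa t : S (mkU t 0 0).
    have H x y z : S (mkU x y z) -> x != z -> S (mkU t 0 0).
      move=> Sx xz; have := SB _ _ (SB _ _ Sx (Sd z)) (Se y).
      rewrite !mkUB subr0 subrr !subr0 subrr => /(SZ (t / (x - z))).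
      by rewrite !mulr0 divfK // subr_eq0.
    have [ac|ac] := eqVneq a c; last exact: H Su ac.
    have [ac'|ac'] := eqVneq a' c'; last exact: H Sv ac'.
    case: uv; rewrite !mkUM ac ac' (mulrC c') (mulrC c' b) (mulrC c b').
    by rewrite [X in mkU _ X _]addrC.
  move=> z; rewrite (U_eta z).
  move: (U_val z 0 0) (U_val z 0 1) (U_val z 1 1) => t s r.
  have -> : mkU t s r = mkU (t - r) 0 0 + mkU 0 s 0 + mkU r 0 r.
    by rewrite !mkUD !add0r !addr0 subrK.
  by do 2?[apply: (SD)].
- move=> I iI [u Iu nzu] x y.
  (* A nonzero entry of u is moved into the corner by multiplying by the matrix unit [mkU 0 1 0];
     the corner line contains all commutators. *)
  have Ie d : I (mkU 0 d 0).
    have H t : t != 0 -> I (mkU 0 t 0) -> I (mkU 0 d 0).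
      move=> t0 It; have -> : mkU 0 d 0 = mkU (d / t) 0 0 * mkU 0 t 0.
        by rewrite mkUM !mul0r mulr0 divfK // addr0.
      exact: is_idealMl.
    move: Iu nzu; rewrite (U_eta u).
    move: (U_val u 0 0) (U_val u 0 1) (U_val u 1 1) => a b c Iu nzu.
    have [a0|a0] := eqVneq a 0; last first.
      apply: (H a a0); have -> : mkU 0 a 0 = mkU a b c * mkU 0 1 0.
        by rewrite mkUM !mulr0 mulr1 addr0.
      exact: is_idealMr.
    have [c0|c0] := eqVneq c 0; last first.
      apply: (H c c0); have -> : mkU 0 c 0 = mkU 0 1 0 * mkU a b c.
        by rewrite mkUM !mul0r mul1r add0r.
      exact: is_idealMl.
    have [b0|b0] := eqVneq b 0; last by apply: (H b b0); rewrite a0 c0 in Iu.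
    by case: nzu; rewrite a0 b0 c0 -mkU0.
  rewrite (U_eta x) (U_eta y) !mkUM mkUB.
  by rewrite [X in mkU (X - _)]mulrC subrr [X in mkU _ _ (X - _)]mulrC subrr.
Qed.

End URing.

Lemma class_U_minimal (R : pzRingType) : class_U R ->
  finite_set [set: R] /\ minimal_noncommutative R.
Proof.
case=> p pr_p /ring_iso_sym iso; split.
  case: (iso) => f [g fK gK]; apply: (finite_surj (f := f)); last exact: U_finite.
  by move=> r; exists (g r).
exact: minimal_noncommutative_iso iso (U_minimal_noncommutative p).
Qed.

(** * Isomorphism invariants separating the classes *)

Definition is_local_over_int (R : pzRingType) : Prop :=
  forall r : R, exists (k : int) (n : nat), (r - k%:~R) ^+ n = 0.

Definition only_trivial_idempotents (R : pzRingType) : Prop :=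
  forall e : R, e * e = e -> e = 0 \/ e = 1.

Lemma is_local_over_int_iso (R S : pzRingType) : ring_iso R S ->
  is_local_over_int R -> is_local_over_int S.
Proof.
move=> [f [g fK gK]] h s; have [k [n kn]] := h (g s); exists k, n.
by rewrite -[s]gK -(rmorph_int f) -rmorphB -rmorphXn kn rmorph0.
Qed.

Lemma only_trivial_idempotents_iso (R S : pzRingType) : ring_iso R S ->
  only_trivial_idempotents R -> only_trivial_idempotents S.
Proof.
move=> [f [g fK gK]] h e ee; have [|ge|ge] := h (g e).
- by apply: (can_inj fK); rewrite rmorphM gK.
- by left; rewrite -(gK e) ge rmorph0.
- by right; rewrite -(gK e) ge rmorph1.
Qed.

Lemma mkUX p (a b c : 'F_p) n : exists b', mkU a b c ^+ n = mkU (a ^+ n) b' (c ^+ n).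
Proof.
elim: n => [|n [b' IH]]; first by exists 0; rewrite !expr0 mkU1.
by exists (a * b' + b * c ^+ n); rewrite !exprS IH mkUM.
Qed.

(** If [mkU 1 0 0] minus k is nilpotent, so are its diagonal entries 1 - k and -k; in a field this
    gives k = 1 and k = 0. *)
Lemma U_not_local (p : nat) : ~ is_local_over_int (U_ring p).
Proof.
move=> /(_ (mkU 1 0 0))[k [n]]; rewrite mkU_int mkUB.
have [b ->] := mkUX (1 - k%:~R) (0 - 0) (0 - k%:~R : 'F_p) n.
rewrite mkU0 => /mkU_inj[/eqP h1 _ /eqP h2]; move: h1 h2.
rewrite !expf_eq0 => /andP[_ /eqP h1] /andP[_ /eqP].
by rewrite sub0r => /eqP; rewrite oppr_eq0 => /eqP h2; move/eqP: h1; rewrite h2 subr0 oner_eq0.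
Qed.

Lemma U_nontrivial_idempotent (p : nat) : ~ only_trivial_idempotents (U_ring p).
Proof.
move=> /(_ (mkU 1 0 0)) []; first by rewrite mkUM !mulr0 mulr1 addr0.
  by rewrite mkU0 => /mkU_inj[/eqP]; rewrite oner_eq0.
by rewrite mkU1 => /mkU_inj[_ _ /eqP]; rewrite eq_sym oner_eq0.
Qed.

Section BRing.
Variables (p k : nat) (pr_p : prime p) (k_gt0 : (0 < k)%N) (e : nat).
Local Notation F := (GF pr_p k_gt0).
Local Notation B := (B_ring pr_p k_gt0 e).
Implicit Types u v : B.
Local Notation s x := (x ^+ (p ^ e)).

Definition mkB_mx (x y : F) : 'M[F]_2 :=
  \matrix_(i, j) if i == 0 then if j == 0 then s x else y
                 else if j == 0 then 0 else x.

Lemma mkB_subproof x y : mkB_mx x y \in @B_pred p k pr_p k_gt0 e.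
Proof. by rewrite unfold_in !mxE !eqxx. Qed.

Definition mkB x y : B := BRing (mkB_subproof x y).

Lemma B10 u : B_val u 1 0 = 0.
Proof. by have /andP[/eqP] := B_valP u. Qed.

Lemma B00 u : B_val u 0 0 = s (B_val u 1 1).
Proof. by have /andP[_ /eqP] := B_valP u. Qed.

Lemma B_eta u : u = mkB (B_val u 1 1) (B_val u 0 1).
Proof. by apply/val_inj/upper_mxP; rewrite ?B10 ?mxE ?B00. Qed.

Lemma mkB_inj x y x' y' : mkB x y = mkB x' y' -> x = x' /\ y = y'.
Proof.
move=> /(congr1 (@B_val _ _ _ _ _)) /= E.
by split; [have := congr1 (fun M : 'M_2 => M 1 1) E
  |have := congr1 (fun M : 'M_2 => M 0 1) E]; rewrite /= !mxE.
Qed.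

Lemma mkBB x y x' y' : mkB x y - mkB x' y' = mkB (x - x') (y - y').
Proof. by rewrite [LHS]B_eta /= !mxE. Qed.

Lemma mkBD x y x' y' : mkB x y + mkB x' y' = mkB (x + x') (y + y').
Proof. by rewrite [LHS]B_eta /= !mxE. Qed.

Lemma mkBM x y x' y' : mkB x y * mkB x' y' = mkB (x * x') (s x * y' + y * x').
Proof.
rewrite [LHS]B_eta /=.
have [_ -> ->] := upper_mulmx (B10 (mkB x y)) (B10 (mkB x' y')).
by rewrite /= !mxE.
Qed.

Lemma mkB1 : (1 : B) = mkB 1 0.
Proof. by rewrite [LHS]B_eta /= !mxE. Qed.

Lemma mkB0 : (0 : B) = mkB 0 0.
Proof. by rewrite [LHS]B_eta /= !mxE. Qed.

Lemma B_finite : finite_set [set: B].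
Proof.
apply: (@finite_surj (F * F)%type _ (fun t => mkB t.1 t.2)).
  by move=> u; exists (B_val u 1 1, B_val u 0 1); rewrite -B_eta.
exact: finite_finset.
Qed.

Lemma B_only_trivial_idempotents : only_trivial_idempotents B.
Proof.
have s_gt0 : (0 < p ^ e)%N by rewrite expn_gt0 prime_gt0.
move=> u; rewrite (B_eta u); move: (B_val u 1 1) (B_val u 0 1) => x y.
rewrite mkBM => /mkB_inj[xx].
have /orP[/eqP->|/eqP->] : (x == 0) || (x == 1).
- by rewrite -(subr_eq0 x 1) -mulf_eq0 mulrBr mulr1 xx subrr.
- by rewrite expr0n gtn_eqF // mul0r mulr0 addr0 => <-; left; rewrite mkB0.
- rewrite expr1n mul1r mulr1 => /eqP; rewrite -subr_eq0 addrK => /eqP->.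
  by right; rewrite mkB1.
Qed.

(** The lower diagonal entry is a ring morphism to F, so it sends an integer plus a nilpotent to an
    integer. Frobenius fixes integers, and with such diagonals the products commute. *)
Lemma B_local_commutative : is_local_over_int B -> ~ noncommutative B.
Proof.
have bM : monoid_morphism (fun u : B => B_val u 1 1).
  split=> [|u v]; first by rewrite mkB1 /= !mxE.
  by rewrite [u]B_eta [v]B_eta mkBM /= !mxE.
have bB : zmod_morphism (fun u : B => B_val u 1 1).
  by move=> u v; rewrite /= !mxE.
pose f := HB.pack_for {rmorphism B -> F} (fun u : B => B_val u 1 1)
  (GRing.isZmodMorphism.Build _ _ _ bB) (GRing.isMonoidMorphism.Build _ _ _ bM).
move=> loc [u [v]]; case.
have fint (w : B) : exists n : int, B_val w 1 1 = n%:~R.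
  have [n [m nm]] := loc w; exists n; apply/eqP; rewrite -subr_eq0.
  have := congr1 f nm; rewrite rmorphXn rmorphB rmorph_int rmorph0 => /eqP.
  by rewrite expf_eq0 => /andP[].
have sint (n : int) : s (n%:~R : F) = n%:~R.
  have pF := pchar_GF pr_p k_gt0; elim: e => [|d IH]; first by rewrite expr1.
  by rewrite expnSr exprM IH -(pFrobenius_autE pF) rmorph_int.
have [n un] := fint u; have [m vm] := fint v.
rewrite (B_eta u) (B_eta v) un vm !mkBM !sint; congr mkB; first exact: mulrC.
by rewrite addrC mulrC [X in _ + X]mulrC.
Qed.

End BRing.

Lemma B_minimal_noncommutative (p q m j : nat) (pr_p : prime p) (pr_q : prime q) :
  (1 <= m)%N -> (1 <= j <= q - 1)%N ->
  minimal_noncommutative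
    (B_ring pr_p (prime_pow_gt0 m pr_q) (j * q ^ (m - 1))%N).
Proof.
move=> m_gt0 /andP[j_gt0 jq]; set k_gt0 := prime_pow_gt0 m pr_q.
set k := (q ^ m)%N; set e := (j * _)%N.
pose F := GF pr_p k_gt0; have pF : p \in [pchar F] := pchar_GF pr_p k_gt0.
have cF : #|F| = (p ^ k)%N := card_GF pr_p k_gt0.
have q_gt0 := prime_gt0 pr_q.
have e_gt0 : (0 < e)%N by rewrite muln_gt0 j_gt0 expn_gt0 q_gt0.
have e_lt : (e < k)%N.
  rewrite /e /k -{2}(subnK m_gt0) addn1 expnS ltn_pmul2r ?expn_gt0 ?q_gt0 //.
  by rewrite -(subnK q_gt0) addn1 ltnS.
have [t pt] := finField_prim_root cF.
have te : t ^+ (p ^ e) <> t by apply: (prim_root_exp_pn pF pt); rewrite e_gt0.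
(* If x were fixed by x -> x^(p^d) with 0 < d < k, it would be fixed for the exponent gcd(d, k) =
   q^i, where i <= m - 1; this divides e = j q^(m-1). *)
have moved (x : F) : x ^+ (p ^ e) <> x -> forall d, (0 < d < k)%N -> x ^+ (p ^ d) <> x.
  move=> xe d /andP[d_gt0 dk] xd.
  have xk : x ^+ (p ^ k) = x by rewrite -cF expf_card.
  have := exp_pn_gcd d_gt0 xd xk.
  have /(dvdn_pfactor _ _ pr_q)[i im gE] : (gcdn d k %| q ^ m)%N by apply: dvdn_gcdr.
  have im1 : (i <= m - 1)%N.
    rewrite leq_subRL // add1n ltn_neqAle im andbT; apply/eqP => ei.
    have : (k %| d)%N by rewrite {1}/k -ei -gE dvdn_gcdl.
    by move/(dvdn_leq d_gt0); rewrite leqNgt dk.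
  rewrite gE => /(exp_pn_mul (j * q ^ (m - 1 - i))).
  by rewrite -mulnA -expnD subnK.
apply/minimal_noncommutativeE; split.
- exists (mkB e t 0), (mkB e 0 1); rewrite !mkBM => /mkB_inj[_].
  by rewrite expr0n gtn_eqF ?expn_gt0 ?prime_gt0 // mulr1 !mul0r add0r addr0 mul1r.
- move=> S SS [u [v [Su Sv]]]; have [S1 SB SM] := SS; have SD := is_subringD SS.
  (* The diagonal entries of S form a subring of F; it contains x, which lies in no proper
     subfield. *)
  have mD x y : S (mkB e x y) -> x ^+ (p ^ e) <> x ->
      forall z, exists y', S (mkB e z y').
    move=> Sxy /moved hx; apply: (subring_generated pF cF _ _ hx).
      split; first by exists 0; rewrite -mkB1.
        by move=> a b [c Sc] [d Sd]; exists (c - d); rewrite -mkBB; apply: SB.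
      move=> a b [c Sc] [d Sd]; eexists; have := SM _ _ Sc Sd.
      by rewrite mkBM; apply.
    by exists y.
  move: Su Sv; rewrite (B_eta u) (B_eta v).
  move: (B_val u 1 1) (B_val u 0 1) (B_val v 1 1) (B_val v 0 1) => x y x' y' Su Sv uv.
  have full : forall z, exists y', S (mkB e z y').
    have [xx|] := pselect (x ^+ (p ^ e) = x); last exact: mD Su.
    have [xx'|] := pselect (x' ^+ (p ^ e) = x'); last exact: mD Sv.
    case: uv; rewrite !mkBM xx xx' [x' * x]mulrC; congr mkB.
    by rewrite addrC mulrC [X in _ + X]mulrC.
  (* The commutator has the form [mkB e 0 z] with z nonzero; right multiplication by an element of S
     with diagonal entry d / z turns z into d. *)
  have SE d : S (mkB e 0 d).
    have := SB _ _ (SM _ _ Su Sv) (SM _ _ Sv Su); rewrite !mkBM mkBB.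
    set w := _ - _; set z := _ - _; have w0 : w = 0 by rewrite /w mulrC subrr.
    have z0 : z != 0.
      apply: contra_not_neq uv => z0; rewrite !mkBM [x' * x]mulrC; congr mkB.
      by apply/eqP; rewrite -subr_eq0 -/z z0.
    rewrite w0 => Sz; have [y1 Sd] := full (d / z); have := SM _ _ Sz Sd.
    rewrite mkBM mul0r expr0n gtn_eqF ?expn_gt0 ?prime_gt0 // mul0r add0r mulrC.
    by rewrite divfK.
  move=> z; rewrite (B_eta z); have [y1 Sz] := full (B_val z 1 1).
  rewrite (_ : mkB e _ _ = mkB e (B_val z 1 1) y1 + mkB e 0 (B_val z 0 1 - y1)).
    exact: SD.
  by rewrite mkBD addr0 addrC subrK.
- move=> I iI [u Iu nzu] v w.
  have Ie d : I (mkB e 0 d).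
    have H t' : t' != 0 -> I (mkB e 0 t') -> I (mkB e 0 d).
      move=> t0 It; have -> : mkB e 0 d = mkB e 0 t' * mkB e (d / t') 0.
        by rewrite mkBM mul0r mulr0 add0r mulrC divfK.
      exact: is_idealMr.
    move: Iu nzu; rewrite (B_eta u); move: (B_val u 1 1) (B_val u 0 1) => x y Iu nzu.
    have [x0|x0] := eqVneq x 0; last first.
      apply: (H (x ^+ (p ^ e))); first by rewrite expf_eq0 negb_and x0 orbT.
      have -> : mkB e 0 (x ^+ (p ^ e)) = mkB e x y * mkB e 0 1.
        by rewrite mkBM !mulr0 mulr1 addr0.
      exact: is_idealMr.
    have [y0|y0] := eqVneq y 0; last by apply: (H y y0); rewrite x0 in Iu.
    by case: nzu; rewrite x0 y0 -mkB0.
  by rewrite (B_eta v) (B_eta w) !mkBM mkBB [X in mkB _ (X - _)]mulrC subrr.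
Qed.

Lemma class_B_minimal (R : pzRingType) : class_B R ->
  finite_set [set: R] /\ minimal_noncommutative R.
Proof.
case=> p [q [m [j [pr_p [pr_q [m1 jq /ring_iso_sym iso]]]]]]; split.
  case: (iso) => f [g fK gK]; apply: (finite_surj (f := f)); last exact: B_finite.
  by move=> r; exists (g r).
exact: minimal_noncommutative_iso iso (B_minimal_noncommutative pr_p pr_q m1 jq).
Qed.

(** * Rings with a nontrivial idempotent *)

Lemma inj_surj_bijective (T U : Type) (f : T -> U) :
  injective f -> (forall u, exists t, f t = u) -> bijective f.
Proof. by move=> fI /choice[g gK]; exists g => // t; apply: fI. Qed.

(** The bound M is chosen before f; this uniformity later bounds the length of nonzero products of
    nilpotents. *)
Lemma finite_pigeonhole (T : eqType) : finite_set [set: T] ->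
  exists M, forall f : nat -> T, exists i j, (i < j <= M)%N /\ f i = f j.
Proof.
move=> /finite_seqP[s sE]; exists (size s) => f; apply: contrapT => nf.
have inj : {in iota 0 (size s).+1 &, injective f}.
  move=> i j; rewrite !mem_iota !add0n !ltnS /= => im jm fij.
  wlog ij : i j im jm fij / (i <= j)%N.
    by move=> W; case/orP: (leq_total i j) => ij; [|apply/esym]; apply: W.
  apply/eqP; rewrite eqn_leq ij leqNgt; apply/negP => lt.
  by apply: nf; exists i, j; rewrite lt jm.
have := @uniq_leq_size _ [seq f i | i <- iota 0 (size s).+1] s.
rewrite map_inj_in_uniq ?iota_uniq // => /(_ isT); rewrite size_map size_iota ltnn.
by move=> h; apply/notF/h => x _; have : [set` s] x by rewrite -sE.
Qed.

Section Idempotent.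
Variable R : pzRingType.
Hypotheses (finR : finite_set [set: R]) (ncR : noncommutative R).
Hypotheses (genR : generated_by_noncommuting R) (comR : commutators_in_ideals R).

Lemma additive_order_gt0 (a : R) : exists2 n, (0 < n)%N & a *+ n = 0.
Proof.
have [M hM] := finite_pigeonhole finR.
have [i [j [/andP[ij _] E]]] := hM (fun n => a *+ n); exists (j - i)%N.
  by rewrite subn_gt0.
by rewrite mulrnBr ?(ltnW ij) // E subrr.
Qed.

Lemma prime_order_multiple (a : R) : a <> 0 ->
  exists p n, [/\ prime p, a *+ n <> 0 & (a *+ n) *+ p = 0].
Proof.
move=> a0; have ex : exists n, (0 < n)%N && (a *+ n == 0).
  by have [n n0 an] := additive_order_gt0 a; exists n; rewrite n0 an eqxx.
have [n /andP[n0 /eqP an] nmin] := ex_minnP ex.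
have n1 : (1 < n)%N.
  by rewrite ltn_neqAle n0 andbT; apply/eqP => n1; apply: a0; rewrite -an -n1.
exists (pdiv n), (n %/ pdiv n)%N; split; first exact: pdiv_prime.
  move=> /eqP h; have := nmin (n %/ pdiv n)%N; rewrite h andbT.
  rewrite divn_gt0 ?pdiv_gt0 // pdiv_leq // => /(_ isT).
  by rewrite leqNgt ltn_Pdiv // prime_gt1 ?pdiv_prime.
by rewrite -mulrnA divnK ?pdiv_dvd.
Qed.

(** As e and a do not commute they generate R, so R is spanned over Z by e, a and 1 - e, which
    multiply like the matrix units e11, e12 and e22. *)
Lemma class_U_of_corner (e a : R) : e * e = e -> e * a = a -> a * e = 0 -> a <> 0 ->
  class_U R.
Proof.
(* A suitable integer multiple of a has prime additive order and satisfies the same relations. *)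
move=> ee; move: a; suff core p a : prime p -> e * a = a -> a * e = 0 -> a <> 0 ->
    a *+ p = 0 -> class_U R.
  move=> a ea ae /prime_order_multiple[p [n [pr_p an pan]]].
  by apply: (core p (a *+ n)); rewrite ?mulrnAr ?mulrnAl ?ea ?ae ?mul0rn.
move=> pr_p ea ae a0 pa; have [e' e'E] : exists e', e' = 1 - e by exists (1 - e).
have aa : a * a = 0 by rewrite -{2}ea mulrA ae mul0r.
have e'e : e' * e = 0 by rewrite e'E mulrBl mul1r ee subrr.
have e'e' : e' * e' = e' by rewrite {2}e'E mulrBr mulr1 e'e subr0.
have ee' : e * e' = 0 by rewrite e'E mulrBr mulr1 ee subrr.
have ae' : a * e' = a by rewrite e'E mulrBr mulr1 ae subr0.
have e'a : e' * a = 0 by rewrite e'E mulrBl mul1r ea subrr.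
pose T k l m : R := k * e + l * a + m * e'.
have TM (x : R) (k l m k' l' m' : R) : (forall r, GRing.comm k' r) ->
    (forall r, GRing.comm l' r) -> (forall r, GRing.comm m' r) ->
    T k l m * T k' l' m' = T (k * k') (k * l' + l * m') (m * m').
  move=> ck cl cm; have cE (u v w z : R) : (forall r, GRing.comm w r) ->
    (u * v) * (w * z) = (u * w) * (v * z).
    by move=> cw; rewrite -!mulrA [v * (w * _)]mulrA -(cw v) -!mulrA.
  rewrite /T !mulrDl !mulrDr.
  rewrite !(cE _ _ _ _ ck) !(cE _ _ _ _ cl) !(cE _ _ _ _ cm) ee ea ee' ae aa ae' e'e e'a e'e'.
  by rewrite !mulr0 !addr0 !add0r addrA.
have Tcorner (k l m : R) : GRing.comm k e -> GRing.comm l e -> GRing.comm m e ->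
    e * T k l m * e' = l * a.
  move=> ck cl cm; rewrite /T !mulrDr !mulrDl !(mulrA e) -ck -cl -cm -!mulrA.
  by rewrite ee' ae' ea e'e' ee' !mulr0 addr0 add0r.
have int_span z : exists k l m : int, z = T k%:~R l%:~R m%:~R.
  apply: (genR (S := fun z => exists k l m : int, z = T k%:~R l%:~R m%:~R)).
    split.
    - by exists 1, 0, 1; rewrite /T !mul1r mul0r addr0 e'E addrC subrK.
    - move=> _ _ [k [l [m ->]]] [k' [l' [m' ->]]].
      exists (k - k'), (l - l'), (m - m'); rewrite /T !rmorphB /= !mulrBl !opprD.
      by rewrite addrACA (addrACA (_ * e)).
    - move=> _ _ [k [l [m ->]]] [k' [l' [m' ->]]].
      exists (k * k'), (k * l' + l * m'), (m * m').
      by rewrite TM ?rmorphD ?rmorphM // => r; apply/commr_sym/commr_int.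
  exists e, a; split; last by rewrite ea ae.
    by exists 1, 0, 0; rewrite /T mul1r !mul0r !addr0.
  by exists 0, 1, 0; rewrite /T mul1r !mul0r addr0 add0r.
(* Otherwise the ideal p R contains the commutator of e and a, which is a. Compressing a = p r by e
   on the left and 1 - e on the right gives a = p l a = 0. *)
have p0 : p%:R = 0 :> R.
  apply: contrapT => p0; pose I : set R := [set p%:R * r | r in [set: R]].
  have iI : is_ideal I by apply: is_ideal_normal => b; exists b; apply: commr_nat.
  have [|r _] := comR iI _ e a; first by exists p%:R => //; exists 1; rewrite ?mulr1.
  rewrite ea ae subr0 => prE; apply: a0.
  have [k [l [m rE]]] := int_span r.
  have -> : a = e * (p%:R * r) * e' by rewrite prE ea ae'.
  have -> : e * (p%:R * r) * e' = p%:R * (e * r * e').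
    by rewrite !mulrA; congr (_ * _ * _); rewrite commr_nat.
  rewrite rE Tcorner; try exact/commr_sym/commr_int.
  by rewrite mulrA -(commr_nat _ p) -mulrA mulr_natl pa mulr0.
have [i iE] := Fp_to_ring pr_p p0.
have iC c r : GRing.comm (i c) r by rewrite iE; apply/commr_sym/commr_nat.
have ia c : i c * a = 0 -> c = 0.
  move=> h; apply/eqP/negPn/negP => c0; apply: a0.
  by rewrite -[a]mul1r -(rmorph1 i) -(mulVf c0) rmorphM -mulrA h mulr0.
pose f (u : U_ring p) : R :=
  T (i (U_val u 0 0)) (i (U_val u 0 1)) (i (U_val u 1 1)).
have fmk x y z : f (mkU x y z) = T (i x) (i y) (i z) by rewrite /f /= !mxE.
have fB : zmod_morphism f.
  move=> u v; rewrite (U_eta u) (U_eta v) mkUB !fmk /T !rmorphB /= !mulrBl !opprD.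
  by rewrite [RHS]addrACA [X in _ = X + _]addrACA.
have fM : monoid_morphism f.
  split; first by rewrite mkU1 fmk /T !rmorph1 rmorph0 mul0r !mul1r addr0 e'E addrC subrK.
  by move=> u v; rewrite (U_eta u) (U_eta v) mkUM !fmk rmorphD !rmorphM TM.
pose f' := HB.pack_for {rmorphism U_ring p -> R} f
  (GRing.isZmodMorphism.Build _ _ f fB) (GRing.isMonoidMorphism.Build _ _ f fM).
exists p => //; apply: ring_iso_sym; exists f'.
apply: inj_surj_bijective; last first.
  move=> z; have [k [l [m ->]]] := int_span z.
  by exists (mkU k%:~R l%:~R m%:~R); rewrite /f' /= fmk !rmorph_int.
move=> u v /eqP; rewrite -subr_eq0 -(rmorphB f') => /eqP fuv.
apply/eqP; rewrite -subr_eq0; apply/eqP; move: (u - v) fuv => {u v} w.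
rewrite /f' /= (U_eta w) fmk; move: (U_val w 0 0) (U_val w 0 1) (U_val w 1 1) => x y z.
(* The three coordinates are isolated by multiplying by a on the right, by e and 1 - e on the two
   sides, and by a on the left. *)
move=> Tw; rewrite mkU0; congr mkU; apply: ia.
- by have := congr1 ( *%R^~ a) Tw; rewrite /T !mulrDl -!mulrA ea aa e'a !mulr0 !addr0 mul0r.
- have := congr1 (fun r => e * r * e') Tw.
  by rewrite Tcorner // mulr0 mul0r.
- have := congr1 ( *%R a) Tw; rewrite /T !mulrDr !mulrA -!(iC _ a) -!mulrA ae aa ae' !mulr0.
  by rewrite !add0r.
Qed.

Lemma class_U_of_idempotent : ~ only_trivial_idempotents R -> class_U R.
Proof.
move=> nt; have [e [ee e0 e1]] : exists e : R, [/\ e * e = e, e <> 0 & e <> 1].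
  apply: contrapT => ne; apply: nt => e ee; apply: contrapT => /not_orP[e0 e1].
  by apply: ne; exists e.
(* For central e, every commutator lies in both e R and (1 - e) R, whose intersection is 0. *)
have [cen|/existsNP[r er]] := pselect (forall r, e * r = r * e).
  have iI (f : R) : (forall r, f * r = r * f) -> is_ideal [set f * r | r in [set: R]].
    by move=> cf; apply: is_ideal_normal => b; exists b.
  have [x [y xy]] := ncR; case: xy; apply/eqP; rewrite -subr_eq0; apply/eqP.
  have [|r _ rE] := comR (iI e cen) _ x y.
    by exists e => //; exists 1; rewrite ?mulr1.
  have cen' t : (1 - e) * t = t * (1 - e) by rewrite mulrBl mulrBr cen mul1r mulr1.
  have [|s _ sE] := comR (iI (1 - e) cen') _ x y.
    exists (1 - e); first by exists 1; rewrite ?mulr1.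
    by move/eqP; rewrite subr_eq0 eq_sym => /eqP.
  by rewrite -rE -ee -mulrA rE -sE mulrA mulrBr mulr1 ee subrr mul0r.
(* One of the corners e r (1 - e) and (1 - e) r e is nonzero; otherwise e r = e r e = r e. *)
have [c0|c0] := pselect (e * r * (1 - e) = 0); last first.
  apply: (class_U_of_corner ee) c0; first by rewrite !mulrA ee.
  by rewrite -mulrA mulrBl mul1r ee subrr mulr0.
have ff : (1 - e) * (1 - e) = 1 - e.
  by rewrite mulrBr mulr1 mulrBl mul1r ee subrr subr0.
apply: (@class_U_of_corner (1 - e) ((1 - e) * r * e)) => //.
- by rewrite !mulrA ff.
- by rewrite -[LHS]mulrA mulrBr mulr1 ee subrr mulr0.
- move=> d0; apply: er; move/eqP: c0; rewrite mulrBr mulr1 subr_eq0 => /eqP->.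
  by apply/eqP; rewrite -subr_eq0 -opprB oppr_eq0 -d0 !mulrBl mul1r.
Qed.

End Idempotent.

(** * Finite rings with only trivial idempotents *)

Definition is_nilpotent (R : pzRingType) (x : R) : Prop := exists n, x ^+ n = 0.

Lemma left_inverseX (R : pzRingType) (x u : R) n : u * x = 1 -> u ^+ n * x ^+ n = 1.
Proof.
move=> ux; elim: n => [|n IH]; first by rewrite mulr1.
by rewrite exprSr exprS -mulrA (mulrA u) ux mul1r.
Qed.

Lemma sub1_nil_unit (R : pzRingType) (x : R) : is_nilpotent x ->
  exists v, (1 - x) * v = 1 /\ v * (1 - x) = 1.
Proof.
case=> n xn; exists (\sum_(i < n) x ^+ i).
have E : (1 - x) * \sum_(i < n) x ^+ i = 1.
  by rewrite -opprB mulNr -subrX1 xn sub0r opprK.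
split=> //; rewrite -[RHS]E; apply/commr_sym; apply: commr_sum => i _.
by apply: commrX; apply/commr_sym/commrB; [apply: commr1|].
Qed.

Section Local.
Variable R : pzRingType.
Hypotheses (finR : finite_set [set: R]) (nz1 : (1 : R) <> 0).
Hypothesis idemR : only_trivial_idempotents R.
Implicit Types x y : R.

(** The powers of x are eventually periodic, so one of them is idempotent, hence 0 or 1. *)
Lemma nil_or_unit x : is_nilpotent x \/ exists2 n, (0 < n)%N & x ^+ n = 1.
Proof.
have [M hM] := finite_pigeonhole finR.
have [i [j [/andP[ij _] E]]] := hM (fun n => x ^+ n).
pose d := (j - i)%N; have d_gt0 : (0 < d)%N by rewrite subn_gt0.
have per m : (i <= m)%N -> x ^+ (m + d) = x ^+ m.
  move=> im; rewrite -(subnK im) -addnA /d subnKC ?(ltnW ij) //.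
  by rewrite !exprD E.
have perk k m : (i <= m)%N -> x ^+ (m + k * d) = x ^+ m.
  move=> im; elim: k => [|k IH]; first by rewrite addn0.
  by rewrite mulSn addnCA addnC per // (leq_trans im) // leq_addr.
(* This exponent is a multiple of the period d and is at least the preperiod i, so doubling it does
   not change the power. *)
pose n := (i.+1 * d)%N.
have idn : x ^+ n * x ^+ n = x ^+ n.
  rewrite -exprD {2}/n perk // /n; apply: leq_trans (leqnSn i) _.
  by rewrite leq_pmulr.
have [h|h] := idemR idn; first by left; exists n.
by right; exists n => //; rewrite muln_gt0.
Qed.

Lemma nil_no_left_inverse x u : is_nilpotent x -> u * x <> 1.
Proof. by case=> n xn ux; apply: nz1; rewrite -(left_inverseX n ux) xn mulr0. Qed.

Lemma nil_no_right_inverse x u : is_nilpotent x -> x * u <> 1.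
Proof. by case=> n xn xu; apply: nz1; rewrite -(left_inverseX n xu) xn mul0r. Qed.

Lemma not_nil1 : ~ is_nilpotent (1 : R).
Proof. by case=> n; rewrite expr1n. Qed.

Lemma nil0 : is_nilpotent (0 : R).
Proof. by exists 1%N; rewrite expr1. Qed.

Lemma nilMl r x : is_nilpotent x -> is_nilpotent (r * x).
Proof.
move=> nx; have [//|[n n_gt0 h]] := nil_or_unit (r * x).
case: (@nil_no_left_inverse x ((r * x) ^+ n.-1 * r) nx).
by rewrite -mulrA -exprSr prednK.
Qed.

Lemma nilMr r x : is_nilpotent x -> is_nilpotent (x * r).
Proof.
move=> nx; have [//|[n n_gt0 h]] := nil_or_unit (x * r).
case: (@nil_no_right_inverse x (r * (x * r) ^+ n.-1) nx).
by rewrite mulrA -exprS prednK.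
Qed.

Lemma nilN x : is_nilpotent x -> is_nilpotent (- x).
Proof. by rewrite -mulN1r; apply: nilMl. Qed.

(** If (x - y)^n = 1, put t = (x - y)^(n-1). Then 1 - t x = - t y would be invertible, as t x is
    nilpotent, and also nilpotent. *)
Lemma nilB x y : is_nilpotent x -> is_nilpotent y -> is_nilpotent (x - y).
Proof.
move=> nx ny; have [//|[n n_gt0 h]] := nil_or_unit (x - y).
have [v [v1 v2]] := sub1_nil_unit (nilMl ((x - y) ^+ n.-1) nx).
case: (@nil_no_right_inverse (- ((x - y) ^+ n.-1 * y)) v).
  exact/nilN/nilMl.
suff <- : 1 - (x - y) ^+ n.-1 * x = - ((x - y) ^+ n.-1 * y) by [].
by rewrite -[1]h -{1}(prednK n_gt0) exprSr mulrBr addrAC subrr sub0r.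
Qed.

Lemma nil_ideal : is_ideal [set x : R | is_nilpotent x].
Proof.
split; first by split; [exact: nil0|exact: nilB].
by move=> a x nx; split; [exact: nilMl|exact: nilMr].
Qed.

Lemma nil_dichotomy x : is_nilpotent x \/ exists u, u * x = 1 /\ x * u = 1.
Proof.
have [h|[n n_gt0 h]] := nil_or_unit x; first by left.
by right; exists (x ^+ n.-1); rewrite -exprSr -exprS prednK.
Qed.

(* Two of the prefixes of a long product coincide; hence P = P * v for some
   prefix P and some nilpotent v, and 1 - v is invertible. *)
Lemma nil_prod : exists M, forall s : seq R,
  (forall a, a \in s -> is_nilpotent a) -> (M <= size s)%N -> \prod_(a <- s) a = 0.
Proof.
have [M hM] := finite_pigeonhole finR; exists M => s ns Ms.
have [i [j [/andP[ij jM] E]]] := hM (fun n => \prod_(a <- take n s) a).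
rewrite /= in E; have js : (j <= size s)%N := leq_trans jM Ms.
have sj : take j s = take i s ++ drop i (take j s).
  by rewrite -{1}(cat_take_drop i (take j s)) take_takel // ltnW.
set w := drop i (take j s) in sj.
have nw : is_nilpotent (\prod_(a <- w) a).
  have : (0 < size w)%N by rewrite size_drop size_takel // subn_gt0.
  have : forall a, a \in w -> is_nilpotent a by move=> a /mem_drop/mem_take; apply: ns.
  case: w {sj} => // a w nw _; rewrite big_cons; apply: nilMr; apply: nw.
  by rewrite mem_head.
have [v [v1 _]] := sub1_nil_unit nw.
have Pw : (\prod_(a <- take i s) a) * (1 - \prod_(a <- w) a) = 0.
  by rewrite mulrBr mulr1 {1}E sj big_cat subrr.
have Pi : \prod_(a <- take i s) a = 0.
  by rewrite -[LHS]mulr1 -[X in _ * X = _]v1 mulrA Pw mul0r.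
by rewrite -(cat_take_drop i s) big_cat /= Pi mul0r.
Qed.

(** Descent from the additive order of 1, a nilpotent integer: a prime divisor that is a unit can be
    cancelled, leaving a smaller nilpotent integer. *)
Lemma nil_prime : exists2 p, prime p & is_nilpotent (p%:R : R).
Proof.
have [n n_gt0 n0] := additive_order_gt0 finR (1 : R).
have : is_nilpotent (n%:R : R) by rewrite n0; apply: nil0.
elim/ltn_ind: n n_gt0 {n0} => n IH n_gt0 nn.
have [n1|n1] := leqP n 1.
  have n1' : n = 1%N by apply/eqP; rewrite eqn_leq n1 n_gt0.
  by case: not_nil1; rewrite -[1]/(1%:R) -n1'.
have pp := pdiv_prime n1.
have [np|[u [up _]]] := nil_dichotomy ((pdiv n)%:R : R); first by exists (pdiv n).
apply: (IH (n %/ pdiv n)%N); first by rewrite ltn_Pdiv // prime_gt1.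
  by rewrite divn_gt0 ?pdiv_gt0 // pdiv_leq.
have <- : u * n%:R = (n %/ pdiv n)%:R.
  by rewrite -{1}(divnK (pdiv_dvd n)) mulnC natrM mulrA up mul1r.
exact: nilMl.
Qed.

(** The list s collects the factors peeled off the ideal power on the left, until the product is
    long enough for [nil_prod]. *)
Lemma nil_ideal_pow_eq0 : exists M, forall n z, (M <= n)%N ->
  ideal_pow [set x : R | is_nilpotent x] n z -> z = 0.
Proof.
have [M hM] := nil_prod; exists M => n z Mn.
suff H k (s : seq R) w : (forall a, a \in s -> is_nilpotent a) -> (n <= k + size s)%N ->
    ideal_pow [set x : R | is_nilpotent x] k w -> (\prod_(a <- s) a) * w = 0.
  by have := H n [::] z; rewrite big_nil mul1r addn0; apply.
elim: k s w => [|k IH] s w ns ks; first by rewrite hM ?mul0r // (leq_trans Mn).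
apply: (set_prodP (C := fun w => (\prod_(a <- s) a) * w = 0)).
  split; first by rewrite mulr0.
  by move=> a b /= a0 b0; rewrite mulrBr a0 b0 subrr.
move=> a b na hb /=; rewrite mulrA.
have -> : (\prod_(a <- s) a) * a = \prod_(a <- rcons s a) a by rewrite big_rcons.
apply: IH => //; last by rewrite size_rcons addnS.
by move=> c; rewrite mem_rcons inE => /orP[/eqP->|/ns].
Qed.

(** Nakayama's lemma for the nilpotent ideal: iterating C inside N C extracts arbitrarily long
    products of nilpotents. *)
Lemma nil_set_prod_l (C : set R) : C `<=` set_prod [set x : R | is_nilpotent x] C ->
  forall z, C z -> z = 0.
Proof.
move=> hC; have [M hM] := nil_prod.
suff H k (s : seq R) z : (forall a, a \in s -> is_nilpotent a) -> (M <= k + size s)%N ->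
    C z -> (\prod_(a <- s) a) * z = 0.
  by move=> z; have := H M [::] z; rewrite big_nil mul1r addn0; apply.
elim: k s z => [|k IH] s z ns ks Cz; first by rewrite hM ?mul0r.
apply: (set_prodP (C := fun w => (\prod_(a <- s) a) * w = 0)) (hC _ Cz).
  split; first by rewrite mulr0.
  by move=> a b /= a0 b0; rewrite mulrBr a0 b0 subrr.
move=> a b na hb /=; rewrite mulrA.
have -> : (\prod_(a <- s) a) * a = \prod_(a <- rcons s a) a by rewrite big_rcons.
apply: IH => //; last by rewrite size_rcons addnS.
by move=> c; rewrite mem_rcons inE => /orP[/eqP->|/ns].
Qed.

Lemma nil_set_prod_r (C : set R) : C `<=` set_prod C [set x : R | is_nilpotent x] ->
  forall z, C z -> z = 0.
Proof.
move=> hC; have [M hM] := nil_prod.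
suff H k (s : seq R) z : (forall a, a \in s -> is_nilpotent a) -> (M <= k + size s)%N ->
    C z -> z * (\prod_(a <- s) a) = 0.
  by move=> z; have := H M [::] z; rewrite big_nil mulr1 addn0; apply.
elim: k s z => [|k IH] s z ns ks Cz; first by rewrite hM ?mulr0.
apply: (set_prodP (C := fun w => w * (\prod_(a <- s) a) = 0)) (hC _ Cz).
  split; first by rewrite mul0r.
  by move=> a b /= a0 b0; rewrite mulrBl a0 b0 subrr.
move=> a b na hb /=; rewrite -mulrA.
have -> : b * (\prod_(a <- s) a) = \prod_(a <- b :: s) a by rewrite big_cons.
apply: IH => //=; last by rewrite addnS.
by move=> c; rewrite inE => /orP[/eqP->|/ns].
Qed.

End Local.

(** * Noncommuting nilpotent elements: images of A *)

Lemma free_eval_pz (R : pzRingType) (x y : R) : (1 : R) <> 0 ->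
  exists f : {rmorphism freeZ2 -> R}, f fx = x /\ f fy = y.
Proof.
move=> /eqP nz1; pose nzR : nzRingType := HB.pack (R : Type) R
  (GRing.PzSemiRing_isNonZero.Build R nz1).
have [f [fX fY]] := @free_eval nzR x y.
have fB : zmod_morphism (f : freeZ2 -> R) := rmorphB f.
have fM : monoid_morphism (f : freeZ2 -> R).
  by split; [exact: rmorph1 f|exact: rmorphM f].
by exists (HB.pack_for {rmorphism freeZ2 -> R} (f : freeZ2 -> R)
  (GRing.isZmodMorphism.Build _ _ _ fB) (GRing.isMonoidMorphism.Build _ _ _ fM)).
Qed.

Lemma rmorph_set_prod (A R : pzRingType) (h : {rmorphism A -> R})
    (I J : set A) (K L : set R) :
  (forall a, I a -> K (h a)) -> (forall a, J a -> L (h a)) ->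
  forall z, set_prod I J z -> set_prod K L (h z).
Proof.
move=> hI hJ; apply: (set_prodP (C := fun z => set_prod K L (h z))).
  have [h0 hB] := set_prod_subgroup K L.
  by split=> [|a b ha hb]; rewrite ?rmorph0 // rmorphB; apply: hB.
by move=> a b Ia Jb; rewrite rmorphM; apply: set_prod_mem; [apply: hI|apply: hJ].
Qed.

(** The morphism h carries J into N, which annihilates the commutator on both sides and satisfies
    N^n = 0; hence each summand of the relation ideal is killed. *)
Lemma rmorph_kills_relations (A R : pzRingType) (h : {rmorphism A -> R})
    (X Y : A) (p n : nat) (N : set R) :
  is_ideal N -> N p%:R -> N (h X) -> N (h Y) ->
  (forall a, N a -> a * (h X * h Y - h Y * h X) = 0) ->
  (forall a, N a -> (h X * h Y - h Y * h X) * a = 0) ->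
  (forall z, ideal_pow N n z -> z = 0) ->
  let J := gen_ideal [set p%:R; X; Y] in
  let c := [set X * Y - Y * X] in
  forall z, set_sum (set_sum (set_prod (set_prod J c) setT)
                             (set_prod (set_prod setT c) J))
                    (ideal_pow J n) z -> h z = 0.
Proof.
move=> iN np nx ny nc cn hn J c.
have hJ z : J z -> N (h z).
  move=> Jz; apply: (Jz (fun z => N (h z))); split.
    split; first split.
    - by rewrite rmorph0; exact: (is_ideal0 iN).
    - by move=> a b Ha Hb; rewrite rmorphB; exact: (is_idealB iN).
    - by move=> a b Hb; rewrite !rmorphM; split; [exact: (is_idealMl iN)|exact: (is_idealMr iN)].
  by move=> _ [[->|->]|->]; rewrite ?rmorph_nat.
have hpow m z : ideal_pow J m z -> ideal_pow N m (h z).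
  elim: m z => [//|m IH] z; exact: rmorph_set_prod hJ IH z.
(* The factor w stands for whatever is multiplied on the right, so nested ideal products can be
   treated one layer at a time. *)
have ker (w : R) : is_subgroup [set z | h z * w = 0].
  by split=> [|a b /= ha hb]; rewrite /= ?rmorph0 ?mul0r // rmorphB mulrBl ha hb subrr.
have prod_ker (I K : set A) (w : R) : (forall a b, I a -> K b -> h a * h b * w = 0) ->
    forall z, set_prod I K z -> h z * w = 0.
  move=> H; apply: (set_prodP (C := [set z | h z * w = 0])) => // a b Ia Kb /=.
  by rewrite rmorphM; apply: H.
move=> _ [_ [z1 Hz1 [z2 Hz2 <-]] [z3 Hz3 <-]]; rewrite !rmorphD.
rewrite (hn _ (hpow _ _ Hz3)) addr0 -[h z1]mulr1 -[h z2]mulr1.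
rewrite (prod_ker _ _ _ _ _ Hz1) ?(prod_ker _ _ _ _ _ Hz2) ?addr0 //.
- move=> a b Ha /hJ Hb; rewrite -mulrA; apply: prod_ker Ha => u v _ -> /=.
  by rewrite rmorphB !rmorphM mulr1 -mulrA cn ?mulr0.
- move=> a b Ha _; rewrite -mulrA; apply: prod_ker Ha => u v /hJ Hu -> /=.
  by rewrite mulrA rmorphB !rmorphM nc ?mul0r.
Qed.

Lemma class_A_of_nil (R : pzRingType) (x y : R) :
  finite_set [set: R] -> minimal_noncommutative R -> only_trivial_idempotents R ->
  is_nilpotent x -> is_nilpotent y -> x * y <> y * x -> class_A R.
Proof.
move=> finR minR idemR nx ny xy; pose N : set R := [set z : R | is_nilpotent z].
have /minimal_noncommutativeE[_ genR comR] := minR.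
have nz1 : (1 : R) <> 0.
  by move=> h; apply: xy; rewrite -[x * y]mul1r -[y * x]mul1r h !mul0r.
have iN : is_ideal N := nil_ideal finR nz1 idemR.
have [p pr_p np] := nil_prime finR nz1 idemR.
have [h [hx hy]] := free_eval_pz x y nz1.
have [M hM] := nil_ideal_pow_eq0 finR nz1 idemR.
pose c := x * y - y * x.
have c0 : c <> 0 by move/eqP; rewrite subr_eq0 => /eqP.
pose C : set R := gen_ideal [set c].
have iC : is_ideal C := gen_ideal_ideal [set c].
have Cc : C c by apply: gen_ideal_sub.
have C_in (D : set R) : is_ideal D -> (exists2 d, D d & d <> 0) -> C `<=` D.
  by move=> iD nzD z; apply; split=> // _ ->; apply: comR.
(* If a c is nonzero, N C is a nonzero ideal and contains the minimal ideal C; Nakayama's lemma then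
   gives c = 0. *)
have nc a : is_nilpotent a -> a * c = 0.
  move=> na; apply: contrapT => ac; apply: c0.
  apply: (nil_set_prod_l finR nz1 idemR (C := C)) (Cc); apply: C_in.
    by apply: set_prod_ideal => b z Hz; [apply: (is_idealMl iN)|apply: (is_idealMr iC)].
  by exists (a * c) => //; exact: (set_prod_mem (na : N a) Cc).
have cn a : is_nilpotent a -> c * a = 0.
  move=> na; apply: contrapT => ca; apply: c0.
  apply: (nil_set_prod_r finR nz1 idemR (C := C)) (Cc); apply: C_in.
    by apply: set_prod_ideal => b z Hz; [apply: (is_idealMl iC)|apply: (is_idealMr iN)].
  by exists (c * a) => //; exact: (set_prod_mem Cc (na : N a)).
(* The exponent must kill the power of N and also be at least 3. *)
exists p, (maxn M 3); split=> //; first exact: leq_maxr.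
apply/image_A_ringP; exists h; split.
  move=> r; apply: (genR (fun r => exists z, h z = r)).
    split=> [|_ _ [a <-] [b <-]|_ _ [a <-] [b <-]].
    - by exists 1; apply: rmorph1.
    - by exists (a - b); apply: rmorphB.
    - by exists (a * b); apply: rmorphM.
  by exists x, y; split=> //; [exists fx|exists fy].
apply: (rmorph_kills_relations (N := N)); rewrite ?hx ?hy // => z Hz.
by apply: hM Hz; apply: leq_maxl.
Qed.

(** * Commuting nilpotent elements: residue field and skew extension *)

Lemma finite_domain_finField (Q : pzRingType) :
  finite_set [set: Q] -> (1 : Q) <> 0 ->
  (forall x y : Q, x * y = 0 -> x = 0 \/ y = 0) ->
  exists (F : finFieldType) (f : {rmorphism Q -> F}), bijective f.
Proof.
move=> /finite_seqP[s0 sE] /eqP nz1 dom; pose s := undup s0.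
have sP (x : Q) : x \in s.
  by rewrite mem_undup; have : [set` s0] x by rewrite -sE.
have pK : pcancel (index^~ s) (fun i => Some (nth 0 s i) : option Q).
  by move=> x; rewrite nth_index.
have eP : Finite.axiom s by move=> x; rewrite count_uniq_mem ?undup_uniq ?sP.
pose cQ := isCountable.Build Q pK.
pose cQT : countType := HB.pack (Q : Type) Q cQ.
pose fQ := isFinite.Build cQT eP.
pose nQ := GRing.PzSemiRing_isNonZero.Build Q nz1.
pose FQ : finNzRingType := HB.pack (Q : Type) Q cQ fQ nQ.
pose UQ : finUnitRingType := HB.pack (FQ : Type) FQ (FinRing.isNzRing.Build FQ).
have domU : GRing.integral_domain_axiom UQ.
  move=> x y xy; have [x0|y0] := dom x y xy; apply/orP; [left|right]; exact/eqP.
(* Wedderburn's little theorem supplies commutativity. *)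
pose F := FinDomainFieldType domU; exists F.
pose g : Q -> F := id.
have gB : zmod_morphism g by [].
have gM : monoid_morphism g by [].
exists (HB.pack_for {rmorphism Q -> F} g
  (GRing.isZmodMorphism.Build _ _ _ gB) (GRing.isMonoidMorphism.Build _ _ _ gM)).
by exists id.
Qed.

(** R = F + a F multiplies by (x + a y)(x' + a y') = x x' + a (s(x) y' + y x'), the rule of [B_ring]
    once s is a Frobenius power with the right exponent. *)
Lemma class_B_of_skew_extension (R : pzRingType) (F : finFieldType)
    (phi : {rmorphism F -> R}) (s : {rmorphism F -> F}) (a : R) :
  generated_by_noncommuting R -> a <> 0 -> a * a = 0 ->
  (forall x, phi x * a = a * phi (s x)) ->
  (forall r, exists x y, r = phi x + a * phi y) ->
  (exists x, s x <> x) -> class_B R.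
Proof.
move=> genR a0 aa phia span [x0 sx0].
have aphi y : a * phi y = 0 -> y = 0.
  move=> h; apply/eqP/negPn/negP => y0; apply: a0.
  by rewrite -[a]mulr1 -(rmorph1 phi) -(divff y0) rmorphM mulrA h mul0r.
have phiaM x r : phi x * (a * r) = a * (phi (s x) * r) by rewrite mulrA phia mulrA.
have mulE x y x' y' : (phi x + a * phi y) * (phi x' + a * phi y') =
    phi (x * x') + a * phi (s x * y' + y * x').
  rewrite mulrDl !mulrDr rmorphD !rmorphM mulrDr -!mulrA !phiaM (mulrA a a) aa.
  by rewrite mul0r addr0 addrA.
have subE x y x' y' : (phi x + a * phi y) - (phi x' + a * phi y') =
    phi (x - x') + a * phi (y - y').
  by rewrite !rmorphB mulrBr opprD addrACA.
(* Right multiplication by a kills the second term and leaves a [phi (s x)], so x = 0. *)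
have eq0 x y : phi x + a * phi y = 0 -> x = 0 /\ y = 0.
  move=> h; have x_0 : x = 0.
    have : s x = 0.
      apply: aphi; have := congr1 ( *%R^~ a) h.
      by rewrite mulrDl -mulrA !phia mulrA aa mul0r addr0 mul0r.
    by move/eqP; rewrite fmorph_eq0 => /eqP.
  by split=> //; apply: aphi; rewrite -h x_0 rmorph0 add0r.
have [p pr_p pF] := finPcharP F.
have [k cF] : exists k, #|F| = (p ^ k)%N.
  by exists (logn p #|F|); apply: card_pprimeChar pF.
have [e ek sE] := finField_endo s pF cF.
have e_gt0 : (0 < e)%N.
  by case: e ek sE => // _ sE; case: sx0; rewrite sE expr1.
have [||q [m [j [pr_q m1 jq kE eE]]]] := fixed_subfields_exponent (e := e) pF cF.
- by rewrite e_gt0.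
(* If s moves some x in S, then S + a F is a subring in which [phi x] and a do not commute. It is
   all of R, and uniqueness of coordinates gives S = F. *)
- move=> S SS [x Sx xe] z; have [S1 SB SM] := SS.
  have := genR (fun r => exists u v, S u /\ r = phi u + a * phi v).
  case/(_ _ _ (phi z)).
  + split.
    * by exists 1, 0; split=> //; rewrite rmorph1 rmorph0 mulr0 addr0.
    * move=> _ _ [u [v [Su ->]]] [u' [v' [Su' ->]]].
      by rewrite subE; do 2!eexists; split; [exact: SB Su Su'|].
    * move=> _ _ [u [v [Su ->]]] [u' [v' [Su' ->]]].
      by rewrite mulE; do 2!eexists; split; [exact: SM Su Su'|].
  + exists (phi x), a; split.
    * by exists x, 0; rewrite rmorph0 mulr0 addr0.
    * exists 0, 1; split; first exact: is_subring0.
      by rewrite rmorph0 rmorph1 mulr1 add0r.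
    * rewrite phia => /eqP; rewrite -subr_eq0 -mulrBr -rmorphB => /eqP/aphi/eqP.
      by rewrite subr_eq0 sE => /eqP.
  + move=> u [v [Su E]]; suff -> : z = u by [].
    have /eq0[/eqP] : phi (z - u) + a * phi (0 - v) = 0.
      by rewrite -subE rmorph0 mulr0 addr0 -E subrr.
    by rewrite subr_eq0 => /eqP.
move: cF; rewrite kE => cF.
have [g bg] := finField_unique (pchar_GF pr_p (prime_pow_gt0 m pr_q)) pF
  (card_GF pr_p (prime_pow_gt0 m pr_q)) cF.
pose B := B_ring pr_p (prime_pow_gt0 m pr_q) (j * q ^ (m - 1)).
pose f (u : B) : R := phi (g (B_val u 1 1)) + a * phi (g (B_val u 0 1)).
have fmk x y : f (mkB (j * q ^ (m - 1)) x y) = phi (g x) + a * phi (g y).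
  by rewrite /f /= !mxE.
have fB : zmod_morphism f.
  by move=> u v; rewrite (B_eta u) (B_eta v) mkBB !fmk subE !rmorphB.
have fM : monoid_morphism f.
  split; first by rewrite (mkB1 pr_p) fmk !rmorph1 !rmorph0 mulr0 addr0.
  move=> u v; rewrite (B_eta u) (B_eta v) mkBM !fmk mulE sE eE.
  by rewrite (rmorphD g) !(rmorphM g) (rmorphXn g).
pose f' := HB.pack_for {rmorphism B -> R} f
  (GRing.isZmodMorphism.Build _ _ f fB) (GRing.isMonoidMorphism.Build _ _ f fM).
exists p, q, m, j, pr_p, pr_q; split=> //; apply: ring_iso_sym; exists f'.
apply: inj_surj_bijective; last first.
  move=> r; have [x [y ->]] := span r; case: bg => g' _ gK.
  by exists (mkB (j * q ^ (m - 1)) (g' x) (g' y)); rewrite /f' /= fmk !gK.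
move=> u v /eqP; rewrite -subr_eq0 -(rmorphB f') => /eqP fuv.
apply/eqP; rewrite -subr_eq0; apply/eqP; move: (u - v) fuv => {u v} w.
rewrite /f' /= (B_eta w) fmk => /eq0[/eqP + /eqP].
by rewrite !fmorph_eq0 => /eqP-> /eqP->; rewrite -mkB0.
Qed.

Lemma exprB_comm_pchar (R : pzRingType) (p k : nat) (x y : R) :
  prime p -> p%:R = 0 :> R -> x * y = y * x ->
  (x - y) ^+ (p ^ k) = x ^+ (p ^ k) - y ^+ (p ^ k).
Proof.
move=> pr_p p0 xy; have [/eqP nz1|/contrapT z1] := pselect ((1 : R) <> 0); last first.
  by rewrite -[LHS]mul1r -[RHS]mul1r z1 !mul0r.
pose nzR : nzRingType := HB.pack (R : Type) R
  (GRing.PzSemiRing_isNonZero.Build R nz1).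
have pR : p \in [pchar nzR] by rewrite inE pr_p /=; apply/eqP.
elim: k => [|k IH]; first by rewrite !expr1.
rewrite expnSr !exprM IH; apply: (@pFrobenius_autB_comm nzR p pR).
by apply/commrX/commr_sym/commrX.
Qed.

Section MinimalRing.
Variables (R : pzRingType).
Hypotheses (finR : finite_set [set: R]) (ncR : noncommutative R).
Hypotheses (genR : generated_by_noncommuting R) (comR : commutators_in_ideals R).
Hypotheses (idemR : only_trivial_idempotents R).

Let nz1 : (1 : R) <> 0.
Proof.
by case: ncR => x [y xy] h; apply: xy; rewrite -[x * y]mul1r -[y * x]mul1r h !mul0r.
Qed.

Let iN : is_ideal [set x : R | is_nilpotent x] := nil_ideal finR nz1 idemR.

(** Every element outside N is invertible, so R/N is a finite domain, hence a field. *)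
Lemma residue_field : exists (F : finFieldType) (pi : {rmorphism R -> F}),
  (forall x, exists r, pi r = x) /\ (forall r, pi r = 0 <-> is_nilpotent r).
Proof.
pose I := Ideal iN; have [q qE] := quot_pi_rmorphism I.
have q0 r : q r = 0 <-> is_nilpotent r.
  by rewrite -(rmorph0 q) !qE; split=> [/quot_eqP|h]; [|apply/quot_eqP]; rewrite /= subr0.
have qS u : exists r, q r = u by exists (repr u); rewrite qE reprK.
have [||x y xy|F [f bf]] := @finite_domain_finField (quot_ring I).
- exact: finite_surj qS finR.
- by rewrite -(rmorph1 q) => /q0; apply: not_nil1.
- move: xy; have [r <-] := qS x; have [t <-] := qS y; rewrite -rmorphM => /q0 rt.
  have [nr|[u [ur _]]] := nil_dichotomy finR idemR r; first by left; apply/q0.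
  right; apply/q0; rewrite -[t]mul1r -ur -mulrA.
  exact: (nilMl finR nz1 idemR).
exists F, (f \o q : {rmorphism R -> F}); split=> [x|r] /=.
  by case: bf => g _ gK; have [r rE] := qS (g x); exists r; rewrite rE gK.
rewrite -q0; split=> [|->]; last exact: rmorph0.
by rewrite -(rmorph0 f) => /(bij_inj bf).
Qed.

Section Residue.
Variables (F : finFieldType) (pi : {rmorphism R -> F}) (p k : nat).
Hypotheses (piS : forall x, exists r, pi r = x) (pi0 : forall r, pi r = 0 <-> is_nilpotent r).
Hypotheses (pF : p \in [pchar F]) (cF : #|F| = (p ^ k)%N).
Local Notation n := (p ^ k).-1.

Let pr_p : prime p := pcharf_prime pF.

Let n_gt0 : (0 < n)%N.
Proof. by have [t /prim_order_gt0] := finField_prim_root cF. Qed.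

Let nK : n.+1 = (p ^ k)%N.
Proof. by rewrite prednK // expn_gt0 prime_gt0. Qed.

Lemma unit_lift r : pi r <> 0 -> exists u, u * r = 1 /\ r * u = 1.
Proof.
move=> r0; have [nr|//] := nil_dichotomy finR idemR r.
by case: r0; apply/pi0.
Qed.

(** Start from any lift u of a primitive root. With p^s the p-part of an exponent d killing u^n, the
    element u^(p^s) works: p^s is coprime to n = p^k - 1, so its image remains primitive. *)
Lemma prim_root_lift : exists w : R, w ^+ n = 1 /\ n.-primitive_root (pi w).
Proof.
have [t pt] := finField_prim_root cF; have [u ut] := piS t.
have [nv|[d d_gt0 vd]] := nil_or_unit finR idemR (u ^+ n).
  move/pi0/eqP: nv; rewrite rmorphXn ut (prim_expr_order pt).
  by rewrite oner_eq0.
have [d' co dE] := pfactor_coprime pr_p d_gt0; set s := logn p d in dE.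
exists (u ^+ (p ^ s)); split; last first.
  rewrite rmorphXn ut prim_root_exp_coprime //.
  rewrite coprimeXl //; apply: coprime_dvdl (coprimenP _); last first.
    by rewrite expn_gt0 prime_gt0.
  by rewrite dvdn_exp // (finField_exponent_gt0 pF cF).
rewrite -exprM mulnC exprM; set v := u ^+ n in vd *.
have pv : pi (v ^+ (p ^ s)) = 1.
  by rewrite rmorphXn /v rmorphXn ut (prim_expr_order pt) expr1n.
set z := v ^+ (p ^ s) in pv *.
have zd : z ^+ d' = 1 by rewrite -exprM mulnC -dE.
(* The geometric sum maps to d', nonzero in F, hence is a unit; since its product with z - 1 is z^d'
   - 1 = 0, z = 1. *)
have [c [_ cE]] : exists c, c * (\sum_(i < d') z ^+ i) = 1 /\ (\sum_(i < d') z ^+ i) * c = 1.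
  apply: unit_lift; rewrite rmorph_sum /=.
  under eq_bigr do rewrite rmorphXn pv expr1n.
  rewrite sumr_const card_ord => /eqP; rewrite -(dvdn_pcharf pF).
  by move: co; rewrite prime_coprime // => /negP.
apply/eqP; rewrite -subr_eq0 -[_ - _]mulr1 -{2}cE mulrA -subrX1 zd subrr mul0r.
exact: eqxx.
Qed.

Variable w : R.
Hypotheses (wn : w ^+ n = 1) (pw : n.-primitive_root (pi w)).
Hypothesis nilC : forall x y : R, is_nilpotent x -> is_nilpotent y -> x * y = y * x.

(** Every element is 0 or a power of w, up to a nilpotent. Were w central, commuting nilpotents
    would make R commutative. *)
Lemma root_not_central : exists r, w * r <> r * w.
Proof.
apply: contrapT => nr; case: ncR => x [y]; apply.
have cw r : w * r = r * w by apply: contrapT => h; apply: nr; exists r.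
have dec (r : R) :
    exists z v, [/\ r = z + v, forall t, z * t = t * z & is_nilpotent v].
  have [r0|r0] := eqVneq (pi r) 0.
    by exists 0, r; split=> [|t|]; rewrite ?add0r ?mul0r ?mulr0 //; apply/pi0.
  have [i E] := prim_root_finField cF pw r0.
  exists (w ^+ i), (r - w ^+ i); split=> [|t|].
  - by rewrite addrC subrK.
  - exact/esym/commrX/esym/cw.
  - by apply/pi0; rewrite rmorphB rmorphXn E subrr.
have [z [v [-> zc nv]]] := dec x; have [z' [v' [-> zc' nv']]] := dec y.
by rewrite !mulrDl !mulrDr (zc z') (zc v') -(zc' v) (nilC nv nv') addrACA.
Qed.

(* A discrete Fourier transform of r under conjugation by w. *)
Lemma eigenvector : exists a c, w * a = a * w ^+ c /\ w * a <> a * w.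
Proof.
pose v := w ^+ n.-1.
have wv : w * v = 1 by rewrite -exprS prednK.
have vn : v ^+ n = 1 by rewrite -exprM mulnC exprM wn expr1n.
have wcn c : (w ^+ c) ^+ n = 1 by rewrite -exprM mulnC exprM wn expr1n.
pose t c r i := v ^+ i * r * (w ^+ c) ^+ i.
pose E c r := \sum_(i < n) t c r i.
have wE c r : w * E c r = E c r * w ^+ c.
  (* The sum can be shifted cyclically because v^n and (w^c)^n are both 1. *)
  have shift : E c r = \sum_(i < n) t c r i.+1.
    rewrite /E -(prednK n_gt0) big_ord_recl [RHS]big_ord_recr /= addrC.
    congr (_ + _); rewrite (prednK n_gt0) /t vn wcn.
    by rewrite !expr0.
  rewrite {1}shift mulr_sumr mulr_suml; apply: eq_bigr => i _.
  by rewrite /t exprS exprSr !mulrA wv mul1r.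
apply: contrapT => nE.
have cE c r : w * E c r = E c r * w.
  by apply: contrapT => h; apply: nE; exists (E c r), c; split; [exact: wE|].
(* Orthogonality: for i <> 0, w^i - 1 is a unit and annihilates the geometric sum over c. If every
   [E c r] commuted with w, so would n r, and then r, as n = p^k - 1 is a unit. *)
have sumE r : \sum_(c < n) E c r = n%:R * r.
  rewrite /E exchange_big /= (bigD1 (Ordinal n_gt0)) //=.
  rewrite [X in _ + X]big1 ?addr0 => [|i i0].
    under eq_bigr do rewrite /t !expr0 mul1r mulr1.
    by rewrite sumr_const card_ord mulr_natl.
  rewrite /t -mulr_sumr; under eq_bigr do rewrite -exprM mulnC exprM.
  have [u [cu _]] : exists u, u * (w ^+ i - 1) = 1 /\ (w ^+ i - 1) * u = 1.
    apply: unit_lift; rewrite rmorphB rmorphXn rmorph1 => /eqP.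
    rewrite subr_eq0 -(prim_order_dvd pw) gtnNdvd //.
    by rewrite lt0n; apply: contra i0 => /eqP h; apply/eqP/val_inj.
  suff -> : \sum_(c < n) (w ^+ i) ^+ c = 0 by rewrite mulr0.
  by rewrite -[LHS]mul1r -cu -mulrA -subrX1 -exprM mulnC exprM wn expr1n subrr mulr0.
have [r] := root_not_central; apply.
have [u [un _]] : exists u, u * (n%:R : R) = 1 /\ n%:R * u = 1.
  apply: unit_lift; rewrite rmorph_nat => /eqP; rewrite -(dvdn_pcharf pF).
  move=> pn; have : (p %| 1)%N.
    by rewrite -(dvdn_addr _ pn) addn1 nK dvdn_exp // (finField_exponent_gt0 pF cF).
  by rewrite dvdn1 => /eqP p1; move: pr_p; rewrite p1.
have : w * (n%:R * r) = n%:R * r * w.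
  by rewrite -sumE mulr_sumr mulr_suml; apply: eq_bigr => c _; apply: cE.
rewrite mulrA (commr_nat w) -!mulrA => /(congr1 ( *%R u)).
by rewrite !mulrA un !mul1r.
Qed.

Definition generated_subring (A : set R) : set R := smallest (@is_subring R) A.

Lemma generated_subring_subring A : is_subring (generated_subring A).
Proof.
split.
- by move=> S [[]].
- by move=> x y Wx Wy S [SS AS]; have [_ SB _] := SS; apply: SB; [apply: Wx|apply: Wy].
- by move=> x y Wx Wy S [SS AS]; have [_ _ SM] := SS; apply: SM; [apply: Wx|apply: Wy].
Qed.

Local Notation W := (generated_subring [set w]).

Lemma commute_subring x : is_subring [set z : R | z * x = x * z].
Proof.
split=> [|y z /= yx zx|y z /= yx zx] /=; first by rewrite mulr1 mul1r.
- by rewrite mulrBl mulrBr yx zx.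
- by rewrite -mulrA zx mulrA yx mulrA.
Qed.

Lemma mem_W : W w. Proof. by move=> S [_]; apply. Qed.

Lemma W_ind (S : set R) : is_subring S -> S w -> forall z, W z -> S z.
Proof. by move=> SS Sw z; apply; split=> // _ ->. Qed.

Lemma W_comm x y : W x -> W y -> x * y = y * x.
Proof.
move=> Wx Wy; apply: (W_ind (commute_subring y)) Wx => /=; apply/esym.
exact: (W_ind (commute_subring w)) Wy.
Qed.

Lemma class_B_of_eigenvector a c : w * a = a * w ^+ c -> w * a <> a * w -> class_B R.
Proof.
move=> wa nwa; have [W1 WB WM] := generated_subring_subring [set w].
have SW := generated_subring_subring [set w].
(* Since w^n = 1, equality of the images of w^c and w would make w^c and w equal. Hence w^c - w is a
   unit. *)
have wc : pi (w ^+ c - w) <> 0.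
  move/eqP; rewrite rmorphB rmorphXn subr_eq0 -{2}[pi w]expr1.
  rewrite (eq_prim_root_expr pw) => /eqP c1; apply: nwa.
  by rewrite wa -(expr_mod c wn) c1 (expr_mod 1 wn) expr1.
have na : is_nilpotent a.
  apply/pi0/eqP/negPn/negP => a0; apply: wc; have := congr1 pi wa.
  rewrite !rmorphM mulrC => /(mulfI a0) E.
  by rewrite rmorphB -E subrr.
have a0 : a <> 0 by move=> a0; apply: nwa; rewrite a0 mulr0 mul0r.
have [u [_ ur]] := unit_lift wc.
have comE : w * a - a * w = a * (w ^+ c - w) by rewrite mulrBr wa.
have Wa z : W z -> exists2 z', W z' & z * a = a * z'.
  apply: (@W_ind (fun z => exists2 z', W z' & z * a = a * z')).
    split.
    - by exists 1; rewrite ?mul1r ?mulr1.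
    - move=> x y [x' Wx' xa] [y' Wy' ya]; exists (x' - y'); first exact: WB.
      by rewrite mulrBl mulrBr xa ya.
    - move=> x y [x' Wx' xa] [y' Wy' ya]; exists (x' * y'); first exact: WM.
      by rewrite -mulrA ya mulrA xa mulrA.
  by exists (w ^+ c) => //; apply: is_subringX SW _ _ mem_W.
(* W + a R is a subring, because W passes through a, and it contains the noncommuting pair w, a. *)
have dec0 (r : R) : exists z s, W z /\ r = z + a * s.
  apply: (genR (S := fun r => exists z s, W z /\ r = z + a * s)).
    split.
    - by exists 1, 0; rewrite mulr0 addr0.
    - move=> _ _ [z [s [Wz ->]]] [z' [s' [Wz' ->]]].
      by exists (z - z'), (s - s'); split; [exact: WB|rewrite mulrBr opprD addrACA].
    - move=> _ _ [z [s [Wz ->]]] [z' [s' [Wz' ->]]]; have [y _ yE] := Wa z Wz.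
      exists (z * z'), (y * s' + s * (z' + a * s')); split; first exact: WM.
      by rewrite mulrDl [z * _]mulrDr [a * (_ + _)]mulrDr !mulrA yE addrA.
  exists w, a; split=> //.
    by exists w, 0; split; [exact: mem_W|rewrite mulr0 addr0].
  by exists 0, 1; split; [exact: is_subring0|rewrite mulr1 add0r].
have Ra (r : R) : exists r', r * a = a * r'.
  have [z [s [Wz ->]]] := dec0 r; have [y _ yE] := Wa z Wz.
  by exists (y + s * a); rewrite mulrDl mulrDr yE mulrA.
(* Otherwise a^2 R contains w a - a w = a (w^c - w). Cancelling the unit gives a = a (a r u) with a
   r u nilpotent, whence a = 0. *)
have aa : a * a = 0.
  apply: contrapT => aa; pose I : set R := [set a * a * r | r in [set: R]].
  have iI : is_ideal I.
    apply: is_ideal_normal => b; have [b1 b1E] := Ra b; have [b2 b2E] := Ra b1.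
    by exists b2; rewrite mulrA b1E -mulrA b2E mulrA.
  have [|r _] := comR iI _ w a; first by exists (a * a) => //; exists 1; rewrite ?mulr1.
  rewrite comE => /(congr1 ( *%R^~ u)); rewrite -[RHS]mulrA ur mulr1 -!mulrA => E.
  have nv : is_nilpotent (a * (r * u)) by exact: (nilMr finR nz1 idemR).
  have [v [v1 _]] := sub1_nil_unit nv; apply: a0.
  have Ev : a * (1 - a * (r * u)) = 0 by rewrite mulrBr mulr1 E subrr.
  by rewrite -[LHS]mulr1 -[X in _ * X = _]v1 [LHS]mulrA Ev mul0r.
have dec (r : R) : exists z s, [/\ W z, W s & r = z + a * s].
  have [z [s [Wz ->]]] := dec0 r; have [z' [s' [Wz' ->]]] := dec0 s.
  by exists z, z'; rewrite mulrDr mulrA aa mul0r addr0.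
(* Otherwise a lies in p R, so a = p z + a p s with z and s in W. As p s is nilpotent, a = p z (1 -
   p s)^(-1), which commutes with w. *)
have p0 : p%:R = 0 :> R.
  apply: contrapT => p0; pose I : set R := [set p%:R * r | r in [set: R]].
  have iI : is_ideal I by apply: is_ideal_normal => b; exists b; apply: commr_nat.
  have [|r _] := comR iI _ w a; first by exists p%:R => //; exists 1; rewrite ?mulr1.
  rewrite comE => /(congr1 ( *%R^~ u)); rewrite -[RHS]mulrA ur mulr1 -mulrA.
  have [z [s [Wz Ws ->]]] := dec (r * u); rewrite mulrDr mulrA -(commr_nat a) -mulrA => E.
  have np : is_nilpotent (p%:R * s).
    by apply: (nilMr finR nz1 idemR); apply/pi0; rewrite rmorph_nat (pcharf0 pF).
  have [v [v1 v2]] := sub1_nil_unit np.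
  have Wp : W p%:R := is_subring_int SW p.
  have xw : (1 - p%:R * s) * w = w * (1 - p%:R * s).
    by apply: W_comm mem_W; apply: WB => //; apply: WM.
  have vw : v * w = w * v.
    by rewrite -[LHS]mulr1 -v1 !mulrA -(mulrA v) -xw !mulrA v2 mul1r.
  have aE : a = p%:R * z * v.
    have : a * (1 - p%:R * s) = p%:R * z by rewrite mulrBr mulr1 -{1}E addrK.
    by move=> <-; rewrite -mulrA v1 mulr1.
  apply: nwa; rewrite aE -[RHS]mulrA vw !mulrA; congr (_ * _).
  by rewrite -[LHS]mulrA; apply: W_comm mem_W _; apply: WM.
(* In characteristic p the solutions of this equation form a subring of the commutative ring W, and
   w is one of them. *)
have Wq z : W z -> z ^+ (p ^ k) = z.
  move=> Wz; suff : [set z | W z /\ z ^+ (p ^ k) = z] z by case.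
  apply: (W_ind (S := [set z | W z /\ z ^+ (p ^ k) = z])) Wz.
    split=> [|x y [Wx xq] [Wy yq]|x y [Wx xq] [Wy yq]]; split; rewrite ?expr1n //.
    - exact: WB.
    - by rewrite (exprB_comm_pchar _ pr_p p0) ?xq ?yq //; apply: W_comm.
    - exact: WM.
    - by rewrite exprMn_comm ?xq ?yq //; apply: W_comm.
  by split; [exact: mem_W|rewrite -nK exprS wn mulr1].
(* Iterating [Wq] writes z as a power of itself with exponent at least its nilpotency exponent m. So
   [pi] is injective on W, and its inverse [phi] embeds F in R. *)
have W0 z : W z -> pi z = 0 -> z = 0.
  move=> Wz /pi0[m zm]; have zq j : z ^+ ((p ^ k) ^ j) = z.
    by elim: j => [|j IH]; rewrite ?expr1 // expnSr exprM IH Wq.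
  rewrite -(zq m) -(subnK (_ : m <= (p ^ k) ^ m)%N); first by rewrite exprD zm mulr0.
  apply/ltnW/ltn_expl; rewrite -nK ltnS; exact: n_gt0.
have Winj z z' : W z -> W z' -> pi z = pi z' -> z = z'.
  move=> Wz Wz' E; apply/eqP; rewrite -subr_eq0; apply/eqP/W0; first exact: WB.
  by rewrite rmorphB E subrr.
have /choice[phi phiP] : forall x, exists z, W z /\ pi z = x.
  move=> x; have [->|x0] := eqVneq x 0.
    by exists 0; split; [exact: is_subring0|exact: rmorph0].
  have [i ->] := prim_root_finField cF pw x0.
  by exists (w ^+ i); split; [exact: is_subringX SW _ _ mem_W|exact: rmorphXn].
have phiW x := (phiP x).1; have piphi x := (phiP x).2.
have phiE z : W z -> phi (pi z) = z by move=> Wz; apply: Winj.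
have phiB : zmod_morphism phi.
  by move=> x y; apply: Winj; rewrite ?rmorphB ?piphi //; apply: WB.
have phiM : monoid_morphism phi.
  split=> [|x y]; apply: Winj; rewrite ?rmorph1 ?rmorphM ?piphi //; exact: WM.
pose phi' := HB.pack_for {rmorphism F -> R} phi
  (GRing.isZmodMorphism.Build _ _ phi phiB) (GRing.isMonoidMorphism.Build _ _ phi phiM).
have aphi y : a * phi y = 0 -> y = 0.
  move=> h; apply/eqP/negPn/negP => y0; apply: a0.
  by rewrite -[a]mulr1 -phiM.1 -(divff y0) phiM.2 mulrA h mul0r.
have /choice[s sE] : forall x, exists y, phi x * a = a * phi y.
  by move=> x; have [z Wz E] := Wa _ (phiW x); exists (pi z); rewrite phiE.
have aphiI x y : a * phi x = a * phi y -> x = y.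
  move=> E; apply/eqP; rewrite -subr_eq0; apply/eqP/aphi.
  by rewrite phiB mulrBr E subrr.
have sB : zmod_morphism s.
  by move=> x y; apply: aphiI; rewrite -sE !phiB mulrBl mulrBr !sE.
have sM : monoid_morphism s.
  split=> [|x y]; apply: aphiI; rewrite -sE.
    by rewrite phiM.1 mul1r mulr1.
  by rewrite !phiM.2 -mulrA sE mulrA sE -mulrA.
pose s' := HB.pack_for {rmorphism F -> F} s
  (GRing.isZmodMorphism.Build _ _ s sB) (GRing.isMonoidMorphism.Build _ _ s sM).
apply: (@class_B_of_skew_extension R F phi' s' a) => //.
  move=> r; have [z [t [Wz Wt ->]]] := dec r.
  by exists (pi z), (pi t); rewrite /= !phiE.
exists (pi w) => /= sw; apply: nwa.
by have := sE (pi w); rewrite sw phiE //; exact: mem_W.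
Qed.

End Residue.
End MinimalRing.

Lemma class_B_of_commuting_nil (R : pzRingType) :
  finite_set [set: R] -> minimal_noncommutative R -> only_trivial_idempotents R ->
  (forall x y : R, is_nilpotent x -> is_nilpotent y -> x * y = y * x) -> class_B R.
Proof.
move=> finR /minimal_noncommutativeE[ncR genR comR] idemR nilC.
have [F [pi [piS pi0]]] := residue_field finR ncR idemR.
have [p pr_p pF] := finPcharP F.
have cF : #|F| = (p ^ logn p #|F|)%N by apply: card_pprimeChar pF.
have [w [wn pw]] := prim_root_lift finR idemR piS pi0 pF cF.
have [a [c [wa nwa]]] := eigenvector finR ncR idemR pi0 pF cF wn pw nilC.
by apply: (class_B_of_eigenvector finR ncR genR comR idemR pi0 pF cF wn pw wa nwa).
Qed.

(** * Classification and disjointness *)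

Lemma finite_minimal_noncommutative_classes (R : pzRingType) :
  finite_set [set: R] -> minimal_noncommutative R ->
  [\/ class_U R, class_B R | class_A R].
Proof.
move=> finR minR; have /minimal_noncommutativeE[ncR genR comR] := minR.
have [idemR|nidem] := pselect (only_trivial_idempotents R); last first.
  by apply: Or31; apply: class_U_of_idempotent.
have [[x [y [nx ny xy]]]|nilC] :=
    pselect (exists x y : R, [/\ is_nilpotent x, is_nilpotent y & x * y <> y * x]).
  by apply: Or33; apply: (class_A_of_nil finR minR idemR nx ny).
apply: Or32; apply: class_B_of_commuting_nil => // x y nx ny.
by apply: contrapT => xy; apply: nilC; exists x, y.
Qed.

Theorem theorem2p2 :
  (forall R : pzRingType,
     (finite_set [set: R] /\ minimal_noncommutative R) <->
     [\/ class_U R, class_B R | class_A R]) /\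
  [/\ forall R S : pzRingType, class_U R -> class_B S -> ~ ring_iso R S,
      forall R S : pzRingType, class_U R -> class_A S -> ~ ring_iso R S
    & forall R S : pzRingType, class_B R -> class_A S -> ~ ring_iso R S].
Proof.
split=> [R|].
  split=> [[finR minR]|]; first exact: finite_minimal_noncommutative_classes.
  case; [exact: class_U_minimal|exact: class_B_minimal|move=> RA].
  by split; [exact: class_A_finite|case: RA => p [n []]].
(* A nontrivial idempotent separates U from B; the property that every element is an integer plus a
   nilpotent separates A from both. *)
split=> R S.
- move=> [p _ RU] [p' [q [m [j [pr_p [pr_q [_ _ SB]]]]]]] RS.
  have BU := ring_iso_trans (ring_iso_sym SB) (ring_iso_trans (ring_iso_sym RS) RU).
  apply: U_nontrivial_idempotent; apply: only_trivial_idempotents_iso BU _.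
  exact: B_only_trivial_idempotents.
- move=> [p _ RU] /class_A_local SA RS; apply: U_not_local.
  exact: is_local_over_int_iso (ring_iso_trans (ring_iso_sym RS) RU) SA.
- move=> RB SA RS; have [_ /minimal_noncommutativeE[[x [y xy]] _ _]] := class_B_minimal RB.
  case: RB => p [q [m [j [pr_p [pr_q [_ _ RB]]]]]].
  apply: (@B_local_commutative p (q ^ m) pr_p (prime_pow_gt0 m pr_q) (j * q ^ (m - 1))).
    apply: is_local_over_int_iso (class_A_local SA).
    exact: ring_iso_trans (ring_iso_sym RS) RB.
  case: RB => f /bij_inj finj; exists (f x), (f y).
  by rewrite -!rmorphM => /finj.
Qed.
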